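(* Let $N\ge2$, $R\ge0$, and let $\Sigma=\mathbb{R}^N$ if $R=0$ and $\Sigma=\{x\in\mathbb{R}^N:|x|>R\}$ if $R>0$. Put $I:=[R,\infty)$. Let $f:I\times\mathbb{R}\to\mathbb{R}$, $(r,u)\mapsto f(r,u)$, be continuous in $r$ and continuously differentiable in $u$, with $f_u$ uniformly continuous and bounded with respect to $r$, i.e. $\lim_{u\to v}\sup_{r\in I}|f_u(r,u)-f_u(r,v)|=0$ for every $v\in\mathbb{R}$ and $\sup_{r\in I,\,|s|\le K}|f_u(r,s)|<\infty$ for every $K>0$. Moreover, assume that there are constants $\rho,\gamma>0$ such that $f_u(|x|,0)<-\gamma$ for all $|x|>\rho$ (with $x\in\Sigma$). Let $u\in C^2(\Sigma)\cap C(\overline\Sigma)$ be a classical uniformly bounded solution of $$-\Delta u=f(|x|,u)\ \text{ in }\Sigma,\qquad u=0\ \text{ on }\partial\Sigma,\qquad \lim_{|x|\to\infty}u(x)=0.$$ If there is $e\in\mathbb{S}^{N-1}$ such that $u(x)\ge u(\sigma_e(x))$ for all $x\in\Sigma(e)$ and $u\not\equiv u\circ\sigma_e$, then $u$ is foliated Schwarz symmetric with respect to some $p\in\mathbb{S}^{N-1}$ and $u$ is strictly decreasing in the polar angle.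
   Context: $\mathbb{S}^{N-1}=\{x\in\mathbb{R}^N:|x|=1\}$. For $e\in\mathbb{S}^{N-1}$: $\Sigma(e):=\{x\in\Sigma:x\cdot e>0\}$ and $\sigma_e(x):=x-2(x\cdot e)e$. If $R=0$, $\partial\Sigma=\emptyset$ and there is no boundary condition. A function $z\in C(\Sigma)$ is foliated Schwarz symmetric with respect to $p\in\mathbb{S}^{N-1}$ if $z$ is axially symmetric with respect to the axis $\mathbb{R}p$ and nonincreasing in the polar angle $\theta=\arccos\left(\frac{x}{|x|}\cdot p\right)\in[0,\pi]$. *)

(* Defs.v *)
From HB Require Import structures.
From mathcomp Require Import all_boot all_order all_algebra.
From mathcomp Require Import all_classical all_reals all_analysis.

Set Implicit Arguments.
Unset Strict Implicit.
Unset Printing Implicit Defensive.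
Import Order.TTheory GRing.Theory Num.Theory.
Import numFieldNormedType.Exports.

Local Open Scope classical_set_scope.
Local Open Scope ring_scope.

(* The norm `|x| that MathComp-Analysis puts on 'rV[R]_N is the sup norm. It   *)
(* induces the usual topology of R^N (used below for limits, continuity,       *)
(* closure and interior), but the Euclidean length has to be defined apart.    *)
Definition dotv (R : realType) (N : nat) (x y : 'rV[R]_N) : R :=
  \sum_(i < N) x ord0 i * y ord0 i.

Definition enorm (R : realType) (N : nat) (x : 'rV[R]_N) : R :=
  Num.sqrt (dotv x x).

Definition usphere (R : realType) (N : nat) : set 'rV[R]_N :=
  [set x | enorm x = 1].
Arguments usphere {R} N _.

Definition Sigma (R : realType) (N : nat) (rad : R) : set 'rV[R]_N :=
  if rad == 0 then [set: 'rV[R]_N] else [set x | rad < enorm x].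
Arguments Sigma {R} N rad _.

Definition half_of (R : realType) (N : nat) (D : set 'rV[R]_N) (e : 'rV[R]_N) :
  set 'rV[R]_N := [set x | D x /\ 0 < dotv x e].

Definition reflection (R : realType) (N : nat) (e x : 'rV[R]_N) : 'rV[R]_N :=
  x - (2 * dotv x e) *: e.

Definition bdry (T : topologicalType) (D : set T) : set T :=
  closure D `\` D°.

Definition partial (R : realType) (N : nat) (i : 'I_N) (u : 'rV[R]_N -> R)
  (x : 'rV[R]_N) : R := 'D_(delta_mx ord0 i) u x.

Definition laplacian (R : realType) (N : nat) (u : 'rV[R]_N -> R)
  (x : 'rV[R]_N) : R := \sum_(i < N) partial i (partial i u) x.

(* Meant for open D, where two-sided derivatives and pointwise continuity at   *)
(* the points of D only depend on the values of u on D.                        *)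
Definition C1_on (R : realType) (N : nat) (D : set 'rV[R]_N)
    (u : 'rV[R]_N -> R) : Prop :=
  {in D, continuous u} /\
  forall i : 'I_N,
    {in D, forall x, derivable u x (delta_mx ord0 i)} /\
    {in D, continuous (partial i u)}.

Definition C2_on (R : realType) (N : nat) (D : set 'rV[R]_N)
    (u : 'rV[R]_N -> R) : Prop :=
  C1_on D u /\ forall i : 'I_N, C1_on D (partial i u).

Definition vanishes_at_infinity (R : realType) (N : nat) (D : set 'rV[R]_N)
    (u : 'rV[R]_N -> R) : Prop :=
  forall eps : R, 0 < eps ->
    exists A : R, forall x, D x -> A < enorm x -> `|u x| < eps.

(* Invariance under all orthogonal maps fixing the axis pointwise. For N = 2   *)
(* the only such proper rotation is the identity, hence O(N) and not SO(N).    *)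
Definition axially_symmetric (R : realType) (N : nat) (D : set 'rV[R]_N)
    (p : 'rV[R]_N) (z : 'rV[R]_N -> R) : Prop :=
  forall A : 'M[R]_N, A *m A^T = 1%:M -> p *m A = p ->
    forall x, D x -> z (x *m A) = z x.

Definition polar_angle (R : realType) (N : nat) (p x : 'rV[R]_N) : R :=
  acos (dotv ((enorm x)^-1 *: x) p).

(* Monotonicity in the angle is on each sphere |x| = r > 0 contained in D; the *)
(* angle is undefined at the origin.                                           *)
Definition nonincreasing_in_angle (R : realType) (N : nat) (D : set 'rV[R]_N)
    (p : 'rV[R]_N) (z : 'rV[R]_N -> R) : Prop :=
  forall x y, D x -> D y -> x != 0 -> y != 0 -> enorm x = enorm y ->
    polar_angle p x <= polar_angle p y -> z y <= z x.

Definition decreasing_in_angle (R : realType) (N : nat) (D : set 'rV[R]_N)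
    (p : 'rV[R]_N) (z : 'rV[R]_N -> R) : Prop :=
  forall x y, D x -> D y -> x != 0 -> y != 0 -> enorm x = enorm y ->
    polar_angle p x < polar_angle p y -> z y < z x.

Definition foliated_schwarz_symmetric (R : realType) (N : nat)
    (D : set 'rV[R]_N) (p : 'rV[R]_N) (z : 'rV[R]_N -> R) : Prop :=
  [/\ {within D, continuous z},
      axially_symmetric D p z
    & nonincreasing_in_angle D p z].

(* Main.v *)
(* Method of rotating planes. Let w_v = u - u o s_v, where s_v is the reflection in the
   hyperplane orthogonal to v, let G be the set of v <> 0 with w_v > 0 on the half of the
   exterior domain where x.v > 0, and Z the set of v with w_v = 0.

   w_v solves a linear equation -Lap w = c w with c bounded, and c < 0 far out. By the strong
   maximum principle, w_v >= 0 on the half domain implies v in G or v in Z; hence limits of G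
   lie in G or Z. G is open: for v' near v in G, a negative minimum of w_v' can lie neither far
   out (there c < 0), nor in a compact part of the half domain of v (there w_v > 0, hence
   w_v' > 0), nor in a thin strip along the hyperplane or a thin shell along the inner
   boundary, where a concave barrier of one variable excludes it.

   No e in G is a sum of two elements z, z' of Z: s_z o s_z' is a rotation that leaves u
   invariant, and it agrees with s_e at a point x with x.e > 0. Since any path from e in G to
   the complement of G meets Z, it follows that Z is a linear hyperplane and G an open half
   space, say G = {v | v.p > 0}. For |x| = |y| the reflection s_(x-y) exchanges x and y, so
   x.p > y.p implies u x > u y, and x.p = y.p implies u x = u y. *)
Require Import Defs.
From HB Require Import structures.
From mathcomp Require Import all_boot all_order all_algebra.
From mathcomp Require Import all_classical all_reals all_analysis.
From mathcomp Require Import ring lra.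
Set Implicit Arguments.
Unset Strict Implicit.
Unset Printing Implicit Defensive.
Import Order.TTheory GRing.Theory Num.Theory.
Import numFieldNormedType.Exports.
Local Open Scope classical_set_scope.
Local Open Scope ring_scope.

(** * The scalar product and reflections *)

Section Dot.
Context {R : realType} {N : nat}.
Implicit Types (x y z v : 'rV[R]_N) (a : R).

Lemma dotvC x y : dotv x y = dotv y x.
Proof. by apply: eq_bigr => i _; rewrite mulrC. Qed.

Lemma dotvDl x y z : dotv (x + y) z = dotv x z + dotv y z.
Proof. by rewrite -big_split; apply: eq_bigr => i _; rewrite mxE mulrDl. Qed.

Lemma dotvZl a x z : dotv (a *: x) z = a * dotv x z.
Proof. by rewrite mulr_sumr; apply: eq_bigr => i _; rewrite mxE mulrA. Qed.

Lemma dotvNl x z : dotv (- x) z = - dotv x z.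
Proof. by rewrite -scaleN1r dotvZl mulN1r. Qed.

Lemma dotvDr x y z : dotv z (x + y) = dotv z x + dotv z y.
Proof. by rewrite dotvC dotvDl !(dotvC z). Qed.

Lemma dotvZr a x z : dotv z (a *: x) = a * dotv z x.
Proof. by rewrite dotvC dotvZl (dotvC z). Qed.

Lemma dotvNr x z : dotv z (- x) = - dotv z x.
Proof. by rewrite dotvC dotvNl (dotvC z). Qed.

Definition dotvE := (dotvDl, dotvDr, dotvNl, dotvNr, dotvZl, dotvZr).

Lemma dot0v x : dotv 0 x = 0.
Proof. by rewrite -(scale0r 0) dotvZl mul0r. Qed.

Lemma dotv_delta x i : dotv x (delta_mx ord0 i) = x ord0 i.
Proof.
rewrite /dotv (bigD1 i) //= mxE !eqxx mulr1 big1 ?addr0// => j ji.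
by rewrite mxE (negbTE ji) mulr0.
Qed.

Lemma dotv_ge0 x : 0 <= dotv x x.
Proof. by apply: sumr_ge0 => i _; rewrite -expr2 sqr_ge0. Qed.

Lemma dotv_eq0 x : (dotv x x == 0) = (x == 0).
Proof.
apply/eqP/eqP => [|->]; last exact: dot0v.
move=> /eqP; rewrite psumr_eq0 => [/allP h|i _]; last by rewrite -expr2 sqr_ge0.
apply/rowP => i; rewrite mxE; apply/eqP.
by have := h i (mem_index_enum _); rewrite -expr2 sqrf_eq0.
Qed.

Lemma dotv_gt0 x : (0 < dotv x x) = (x != 0).
Proof. by rewrite lt0r dotv_eq0 dotv_ge0 andbT. Qed.

Lemma dotv_CauchySchwarz x y : dotv x y ^+ 2 <= dotv x x * dotv y y.
Proof.
have [->|y0] := eqVneq y 0; first by rewrite dotvC !dot0v expr0n mulr0.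
have yy : 0 < dotv y y by rewrite dotv_gt0.
have := dotv_ge0 (dotv y y *: x - dotv x y *: y).
have -> : dotv (dotv y y *: x - dotv x y *: y) (dotv y y *: x - dotv x y *: y) =
  dotv y y * (dotv x x * dotv y y - dotv x y ^+ 2).
  by rewrite !dotvE (dotvC y x); ring.
by rewrite pmulr_rge0// subr_ge0.
Qed.

Lemma sqr_enorm x : enorm x ^+ 2 = dotv x x.
Proof. by rewrite sqr_sqrtr// dotv_ge0. Qed.

Lemma enorm_ge0 x : 0 <= enorm x.
Proof. exact: sqrtr_ge0. Qed.

Lemma lt_enorm a x : 0 <= a -> (a < enorm x) = (a ^+ 2 < dotv x x).
Proof.
by move=> a0; rewrite -sqr_enorm ltr_pXn2r// nnegrE// enorm_ge0.
Qed.

Lemma norm_le_enorm x : `|x| <= enorm x.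
Proof.
rewrite [leLHS]/Num.norm /= mx_normrE; apply: bigmax_le => [|[k i] _ /=].
  exact: enorm_ge0.
rewrite -sqrtr_sqr ord1; apply: ler_wsqrtr.
rewrite /dotv (bigD1 i) //= -expr2 lerDl.
by apply: sumr_ge0 => j _; rewrite -expr2 sqr_ge0.
Qed.

(* v need not be a unit vector; refl 0 is the identity, since x / 0 = 0. *)
Definition refl v x : 'rV[R]_N := x - (2 * dotv x v / dotv v v) *: v.

Lemma reflectionE v x : usphere N v -> reflection v x = refl v x.
Proof. by move=> v1; rewrite /reflection /refl -sqr_enorm v1 expr1n divr1. Qed.

Lemma dotv_refl v x y : v != 0 -> dotv (refl v x) (refl v y) = dotv x y.
Proof.
rewrite -dotv_eq0 => v0.
by rewrite /refl !dotvE (dotvC v y); field.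
Qed.

Lemma dotv_refll v x : v != 0 -> dotv (refl v x) v = - dotv x v.
Proof. by rewrite -dotv_eq0 => v0; rewrite /refl !dotvE; field. Qed.

Lemma reflK v x : v != 0 -> refl v (refl v x) = x.
Proof.
move=> v0; rewrite {1}/refl dotv_refll// {1}/refl -addrA -opprD -scalerDl.
by rewrite mulrN mulNr subrr scale0r subr0.
Qed.

Lemma reflD v x y : refl v (x + y) = refl v x + refl v y.
Proof.
by rewrite /refl dotvDl mulrDr mulrDl scalerDl opprD addrACA.
Qed.

Lemma reflZ v a x : refl v (a *: x) = a *: refl v x.
Proof.
by rewrite /refl dotvZl scalerBr scalerA; congr (_ - _ *: _); ring.
Qed.

Lemma refl_scale a v x : a != 0 -> refl (a *: v) x = refl v x.
Proof.
have [->|v0] := eqVneq v 0; first by rewrite scaler0.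
move: v0; rewrite -dotv_eq0 => v0 a0.
rewrite /refl !dotvE scalerA; congr (_ - _ *: _); field.
by rewrite a0 v0.
Qed.

Lemma reflN v x : refl (- v) x = refl v x.
Proof. by rewrite -scaleN1r refl_scale// oppr_eq0 oner_neq0. Qed.

Lemma refl_orth v x : dotv x v = 0 -> refl v x = x.
Proof. by move=> xv; rewrite /refl xv mulr0 mul0r scale0r subr0. Qed.

Lemma refl_swap x y : dotv x x = dotv y y -> refl (x - y) x = y.
Proof.
have [->|xy] := eqVneq x y; first by rewrite subrr /refl scaler0 subr0.
move=> h; have : dotv (x - y) (x - y) != 0 by rewrite dotv_eq0 subr_eq0.
rewrite /refl => h0.
suff -> : 2 * dotv x (x - y) / dotv (x - y) (x - y) = 1.
  by rewrite scale1r opprB addrC subrK.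
apply: (canLR (mulfK h0)).
by rewrite mul1r !dotvE (dotvC y x) -h; ring.
Qed.

Lemma cvg_dotv {T : Type} (F : set_system T) {FF : Filter F}
    (f g : T -> 'rV[R]_N) x y :
  f @ F --> x -> g @ F --> y -> dotv (f t) (g t) @[t --> F] --> dotv x y.
Proof.
move=> fx gy; apply: cvg_big => [|i _]; first exact: add_continuous.
have coord (h : T -> 'rV[R]_N) z : h @ F --> z -> h t ord0 i @[t --> F] --> z ord0 i.
  by move=> hz; apply: (cvg_comp h (fun M : 'rV[R]_N => M ord0 i) hz); exact: coord_continuous.
by apply: cvgM; exact: coord.
Qed.

Lemma cvg_reflection {T : Type} (F : set_system T) {FF : Filter F}
    (f g : T -> 'rV[R]_N) v x :
  v != 0 -> f @ F --> v -> g @ F --> x -> refl (f t) (g t) @[t --> F] --> refl v x.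
Proof.
move=> v0 fv gx; apply: cvgB => //; apply: cvgZ => //.
apply: cvgM; first by apply: cvgM; [exact: cvg_cst|exact: cvg_dotv].
by apply: cvgV; [rewrite dotv_eq0|exact: cvg_dotv].
Qed.

End Dot.

(** * Second derivatives and the Laplacian *)

(** [l] is the second derivative of [phi] at 0. A relation with witness [phi'] carries the existence
    of both derivatives along with the value. *)
Definition D2at (R : realType) (phi : R -> R) (l : R) : Prop :=
  exists phi' : R -> R,
    (\forall t \near (0 : R), is_derive (t : R) (1 : R) phi (phi' t)) /\
    is_derive (0 : R) (1 : R) phi' l.

(** Involves only the restrictions of [g] to the coordinate lines through [x], so that composites
    with reflections and explicit barriers are treated alike. *)
Definition lap_at (R : realType) (N : nat) (g : 'rV[R]_N -> R) (x : 'rV[R]_N)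
    (L : R) : Prop :=
  exists2 l : 'I_N -> R,
    forall i, D2at (fun t => g (x + t *: delta_mx ord0 i)) (l i) & L = \sum_i l i.

Section SecondDerivative.
Context {R : realType}.
Implicit Types (phi psi : R -> R) (F : {poly R}).

Lemma D2at_axpy k phi psi a b :
  D2at phi a -> D2at psi b -> D2at (fun t => phi t + k * psi t) (a + k * b).
Proof.
move=> [phi' [h1 h2]] [psi' [h3 h4]]; exists (fun t => phi' t + k * psi' t).
split; last exact: is_deriveD.
near=> t.
have ? : is_derive t (1 : R) phi (phi' t) by near: t.
have ? : is_derive t (1 : R) psi (psi' t) by near: t.
exact: is_deriveD.
Unshelve. all: by end_near. Qed.

Lemma D2at_poly_quadratic F (a b c : R) :
  D2at (fun t => F.[a + b * t + c * t ^+ 2])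
    (F^`()^`().[a] * b ^+ 2 + F^`().[a] * (2 * c)).
Proof.
pose q : R -> R := fun t => a + b * t + c * t ^+ 2.
have dq (t : R) : is_derive t 1 q (b + 2 * c * t).
  rewrite /q; apply: is_derive_eq.
  rewrite /GRing.scale /=; ring.
exists (fun t => F^`().[q t] * (b + 2 * c * t)); split.
  by near=> t; exact: (@is_derive1_comp _ (horner F) q).
have d1 : is_derive (0 : R) 1 (horner F^`() \o q) (F^`()^`().[q 0] * (b + 2 * c * 0)).
  exact: is_derive1_comp.
have d2 : is_derive (0 : R) 1 (fun t : R => b + 2 * c * t) (2 * c).
  by apply: is_derive_eq; rewrite add0r /GRing.scale /=; ring.
apply: (@is_derive_eq _ _ _ _ _ _ _ _ (is_deriveM d1 d2)).
rewrite /GRing.scale /= /q expr0n /= !mulr0 !addr0; ring.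
Unshelve. all: by end_near. Qed.

(** If [l] were negative, then, as [phi'] vanishes at the minimum 0, [phi'] would be negative on
    some interval to the right of 0, and by the mean value theorem [phi] would drop below
    [phi 0]. *)
Lemma D2at_min phi l :
  D2at phi l -> (\forall t \near (0 : R), phi 0 <= phi t) -> 0 <= l.
Proof.
move=> [phi' [h1 h2]] h3; rewrite leNgt; apply/negP => l0.
have [d /= d0 hd] : \forall t \near (0 : R),
  is_derive (t : R) (1 : R) phi (phi' t) /\ phi 0 <= phi t by near=> t; split; near: t.
have hd1 (t : R) : `|t| < d -> is_derive t 1 phi (phi' t).
  by move=> td; apply: (hd t _).1; rewrite /= sub0r normrN.
have hd2 (t : R) : `|t| < d -> phi 0 <= phi t.
  by move=> td; apply: (hd t _).2; rewrite /= sub0r normrN.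
have phi'0 : phi' 0 = 0.
  have h0 : `|0 : R| < d by rewrite normr0.
  have dd : - d <= d by lra.
  have dphi t : t \in `]-d, d[ -> derivable phi t 1.
    by rewrite in_itv /= -ltr_norml => /hd1 [].
  have m0 : 0 \in `]-d, d[ by rewrite in_itv /= -ltr_norml.
  have dmin t : t \in `]-d, d[ -> phi 0 <= phi t.
    by rewrite in_itv /= -ltr_norml => /hd2.
  have [_ dphi0] := derive1_at_min dd dphi m0 dmin.
  by have [_ <-] := hd1 _ h0.
have [t [/andP[t0 td] pt]] : exists t, 0 < t < d /\ forall s, 0 < s <= t -> phi' s < 0.
  have [ex vl] := h2.
  have : (fun h : R => h^-1 *: (phi' (h *: 1 + 0) - phi' 0)) @ 0^' --> l.
    by rewrite -vl; exact: ex.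
  move=> /cvgr_lt /(_ _ l0) [r /= r0 hr].
  exists (Num.min r d / 2); split.
    have : 0 < Num.min r d by rewrite lt_min r0 d0.
    have : Num.min r d <= d by rewrite ge_min lexx orbT.
    by lra.
  move=> s /andP[s0 sr].
  have sr' : s < r.
    apply: le_lt_trans sr _; have : Num.min r d <= r by rewrite ge_min lexx.
    have : 0 < Num.min r d by rewrite lt_min r0 d0.
    lra.
  have := hr s; rewrite /= sub0r normrN gtr0_norm// => /(_ sr' (lt0r_neq0 s0)).
  rewrite addr0 phi'0 subr0 /GRing.scale /= mulr1.
  by rewrite pmulr_rlt0// invr_gt0.
have ht s : 0 <= s <= t -> `|s| < d.
  by move=> /andP[s0 st]; rewrite ger0_norm//; lra.
have [||c /andP[c0 ct] e] := @MVT R phi phi' 0 t t0.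
- move=> s; rewrite in_itv /= => /andP[s0 st]; apply: hd1; apply: ht.
  by rewrite !ltW.
- apply: derivable_within_continuous => s; rewrite in_itv /= => st.
  by case: (hd1 s (ht _ st)).
have c0' : 0 < c by move: c0; rewrite bnd_simp.
have ct' : c <= t by move: ct; rewrite bnd_simp => /ltW.
have : phi 0 <= phi t by apply/hd2/ht; rewrite lexx ltW.
rewrite -subr_ge0 e subr0 pmulr_lge0// leNgt => /negP; apply.
by apply: pt; rewrite c0'.
Unshelve. all: by end_near. Qed.

End SecondDerivative.

Section Laplacian.
Context {R : realType} {N : nat}.
Implicit Types (g h u : 'rV[R]_N -> R) (x y v a : 'rV[R]_N) (D : set 'rV[R]_N).

Lemma lap_at_axpy k g h x L M :
  lap_at g x L -> lap_at h x M -> lap_at (fun y => g y + k * h y) x (L + k * M).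
Proof.
move=> [l hl ->] [m hm ->]; exists (fun i => l i + k * m i) => [i|].
  exact: D2at_axpy.
by rewrite big_split mulr_sumr.
Qed.

Lemma near_line x a (t0 : R) (P : set 'rV[R]_N) :
  (\forall y \near (x + t0 *: a), P y) -> \forall t \near t0, P (x + t *: a).
Proof.
move=> h; have : (fun t => x + t *: a) @ t0 --> x + t0 *: a.
  by apply: cvgD; [exact: cvg_cst|apply: cvgZ; [exact: cvg_id|exact: cvg_cst]].
by apply.
Qed.

Lemma lap_at_min g x L :
  lap_at g x L -> (\forall y \near x, g x <= g y) -> 0 <= L.
Proof.
move=> [l hl ->] hx; apply: sumr_ge0 => i _; apply: D2at_min (hl i) _.
rewrite scale0r addr0.
by apply: (@near_line x _ 0 (fun y => g x <= g y)); rewrite scale0r addr0.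
Qed.

End Laplacian.

(** * Directional derivatives of C^1 and C^2 functions; Laplacians in orthonormal frames *)

Section ChainRule.
Context {R : realType} {N : nat}.
Implicit Types (g u : 'rV[R]_N -> R) (x y v a b : 'rV[R]_N) (D : set 'rV[R]_N).

Lemma is_derive_line g y a (t : R) d : is_derive (y + t *: a) a g d ->
  is_derive t (1 : R) (fun s => g (y + s *: a)) d.
Proof.
have E : (fun h : R => h^-1 *: (((fun s => g (y + s *: a)) \o shift t) (h *: 1)
      - g (y + t *: a))) =
    (fun h : R => h^-1 *: ((g \o shift (y + t *: a)) (h *: a) - g (y + t *: a))).
  apply/funext => h /=; congr (_ *: (g _ - _)).
  by rewrite -[h *: 1]/(h * 1) mulr1 scalerDl addrCA.
by case=> dg <-; split; rewrite /derivable /derive E.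
Qed.

(** The mean value theorem along the [i]-th coordinate turns the quotient into [c] times the partial
    derivative at a point that tends to [x] with [h]. The displacement [h *: b] lets coordinates be
    added one after the other. *)
Lemma cvg_partial_increment D g i x b (c : R) :
  open D -> D x -> (forall z, D z -> derivable g z (delta_mx ord0 i)) ->
  {for x, continuous (partial i g)} ->
  h^-1 * (g (x + h *: b + (h * c) *: delta_mx ord0 i) - g (x + h *: b))
    @[h --> (0 : R)^'] --> c * partial i g x.
Proof.
move=> oD Dx dg cg; apply/cvgrPdist_lt => eps eps0.
have cc : c * partial i g z @[z --> x] --> c * partial i g x.
  exact: (@cvgM _ _ (nbhs x) _ (cst c) (partial i g) _ _ (cvg_cst c) cg).
have nD := open_nbhs_nbhs (conj oD Dx).
move/cvgrPdist_lt: cc => /(_ eps eps0) hc.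
have [r /= r0 hr] := (nbhs_ballP _ _).1 (filterI nD hc).
(* |h| m bounds the distance from [x] of every [q s] below; the summand 1 makes [m] positive. *)
set m := `|b| + `|c| * `|delta_mx ord0 i : 'rV[R]_N| + 1.
have m0 : 0 < m by rewrite ltr_wpDl// addr_ge0// mulr_ge0.
exists (r / m) => /=; first by rewrite divr_gt0.
move=> h /=; rewrite sub0r normrN ltr_pdivlMr// => hm h0.
pose q (s : R) := x + h *: b + s *: ((h * c) *: delta_mx ord0 i).
have hq (s : R) : 0 <= s <= 1 -> D (q s) /\ `|c * partial i g x - c * partial i g (q s)| < eps.
  move=> /andP[s0 s1]; apply: hr; rewrite -ball_normE /= /q.
  rewrite -addrA opprD addNKr normrN; apply: le_lt_trans hm.
  rewrite (le_trans (ler_normD _ _))// !normrZ.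
  rewrite /m !mulrDr mulr1; apply: ler_wpDr => //; apply: lerD => //.
  by rewrite [leRHS]mulrA ger0_norm// ler_piMl// !mulr_ge0.
have dq (s : R) : 0 <= s <= 1 -> is_derive s (1 : R) (fun s => g (q s)) (h * c * partial i g (q s)).
  move=> hs; have [/dg dgq _] := hq s hs.
  have : is_derive (q s) (delta_mx ord0 i) g (partial i g (q s)) by exact: DeriveDef.
  rewrite /q scalerA => /is_derive_line d1.
  pose l (s : R) := s * (h * c).
  have d2 : is_derive s (1 : R) l (h * c).
    by apply: is_derive_eq; rewrite /GRing.scale /=; ring.
  have -> : (fun s => g (q s)) =
      (fun s => g (x + h *: b + s *: delta_mx ord0 i)) \o l.
    by apply/funext => w; rewrite /= /q /l scalerA.
  by rewrite mulrC; exact: is_derive1_comp.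
have [s /= s01||s s01] := @MVT_segment R (fun s => g (q s))
    (fun s => h * c * partial i g (q s)) 0 1 ler01.
- by apply: dq; move: s01; rewrite in_itv /= => /andP[/ltW-> /ltW].
- apply: derivable_within_continuous => s; rewrite in_itv /= => /dq.
  by case.
rewrite /q scale1r scale0r addr0 subr0 mulr1 => ->.
rewrite -mulrA mulKf//; apply: (hq s _).2.
by move: s01; rewrite in_itv.
Qed.

(** The direction [a] is assembled along the list of indices; each new coordinate contributes by
    [cvg_partial_increment]. *)
Lemma is_derive_C1 D g x a : open D -> C1_on D g -> D x ->
  is_derive x a g (\sum_i a ord0 i * partial i g x).
Proof.
move=> oD [_ C1g] Dx.
pose d i : 'rV[R]_N := delta_mx ord0 i.
have step (s : seq 'I_N) :
    h^-1 * (g (x + h *: (\sum_(i <- s) a ord0 i *: d i)) - g x) @[h --> (0 : R)^']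
      --> \sum_(i <- s) a ord0 i * partial i g x.
  elim: s => [|i s IH].
    under eq_fun do rewrite big_nil scaler0 addr0 subrr mulr0.
    by rewrite big_nil; exact: cvg_cst.
  rewrite !big_cons.
  have [dg cg] := C1g i.
  have := @cvg_partial_increment D g i x (\sum_(i <- s) a ord0 i *: d i) (a ord0 i) oD Dx.
  have dg' z : D z -> derivable g z (delta_mx ord0 i) by move=> /mem_set; exact: dg.
  move=> /(_ dg' (cg x (mem_set Dx))) h1.
  apply: cvg_trans (cvgD h1 IH); apply: near_eq_cvg; near=> h => /=.
  rewrite /= -mulrDr; congr (_ * _).
  rewrite addrA subrK scalerDr scalerA; congr (g _ - _).
  by rewrite -addrA [_ + (h * _) *: _]addrC.
have {step} := step (index_enum 'I_N).
rewrite -row_sum_delta => h1.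
have h2 : (fun h : R => h^-1 *: ((g \o shift x) (h *: a) - g x)) @ 0^' -->
    \sum_i a ord0 i * partial i g x.
  apply: cvg_trans h1; apply: near_eq_cvg; near=> h.
  by rewrite /= [h *: a + x]addrC.
by split; [apply/cvg_ex; eexists; exact: h2|exact: cvg_lim h2].
Unshelve. all: by end_near. Qed.

Lemma D2at_C2 D u y a : open D -> C2_on D u -> D y ->
  D2at (fun t => u (y + t *: a))
    (\sum_i a ord0 i * \sum_j a ord0 j * partial j (partial i u) y).
Proof.
move=> oD [C1u C2u] Dy.
exists (fun t => \sum_i a ord0 i * partial i u (y + t *: a)); split.
  have : \forall t \near (0 : R), D (y + t *: a).
    by apply: (@near_line _ _ y a 0 D); rewrite scale0r addr0; exact: open_nbhs_nbhs.
  by apply: filterS => t Dt; apply: is_derive_line; exact: is_derive_C1 C1u Dt.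
have -> : (fun t => \sum_i a ord0 i * partial i u (y + t *: a)) =
    \sum_i (fun t : R => a ord0 i * partial i u (y + t *: a)).
  by apply/funext => t; rewrite fct_sumE.
apply: is_derive_sum => i.
have h : is_derive (0 : R) (1 : R) (fun t => partial i u (y + t *: a))
    (\sum_j a ord0 j * partial j (partial i u) y).
  apply: is_derive_line; rewrite scale0r addr0.
  exact: is_derive_C1 (C2u i) Dy.
by have := is_deriveZ (a ord0 i) h.
Qed.

(** This is tr(A H A^T) = tr(H A^T A) = tr H, the vectors [A i] being the rows of a matrix with A^T
    A = 1. *)
Lemma trace_frame (A : 'I_N -> 'rV[R]_N) (H : 'I_N -> 'I_N -> R) :
  (forall j k, \sum_i A i ord0 j * A i ord0 k = (j == k)%:R) ->
  \sum_i \sum_j A i ord0 j * \sum_k A i ord0 k * H k j = \sum_j H j j.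
Proof.
move=> orthA; rewrite exchange_big; apply: eq_bigr => j _ /=.
under eq_bigr do rewrite mulr_sumr.
rewrite exchange_big /= (bigD1 j) //= [X in _ + X]big1 ?addr0 => [|k kj].
  by under eq_bigr do rewrite mulrA; rewrite -mulr_suml orthA eqxx mul1r.
by under eq_bigr do rewrite mulrA; rewrite -mulr_suml orthA eq_sym (negbTE kj) mul0r.
Qed.

(** The coordinate lines through [x] correspond to the lines through [y] in the directions [A i],
    and the trace of the Hessian of [u] is the same in both frames. Used with the standard frame and
    with a reflected one. *)
Lemma lap_at_frame D u w x y (A : 'I_N -> 'rV[R]_N) :
  open D -> C2_on D u -> D y ->
  (forall j k, \sum_i A i ord0 j * A i ord0 k = (j == k)%:R) ->
  (forall t i, w (x + t *: delta_mx ord0 i) = u (y + t *: A i)) ->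
  lap_at w x (laplacian u y).
Proof.
move=> oD C2u Dy orthA wu.
exists (fun i => \sum_j A i ord0 j * \sum_k A i ord0 k * partial k (partial j u) y).
  move=> i; rewrite (_ : (fun t => w _) = (fun t => u (y + t *: A i))).
    exact: D2at_C2 oD C2u Dy.
  by apply/funext => t.
by rewrite (trace_frame (fun k j => partial k (partial j u) y)).
Qed.

Lemma lap_at_C2 D u x : open D -> C2_on D u -> D x -> lap_at u x (laplacian u x).
Proof.
move=> oD C2u Dx; apply: (lap_at_frame (A := delta_mx ord0) oD C2u Dx) => // j k.
rewrite (bigD1 j) //= big1 ?addr0 => [|i ij].
  by rewrite !mxE !eqxx mul1r eq_sym.
by rewrite !mxE eqxx eq_sym (negbTE ij) mul0r.
Qed.

Lemma lap_at_refl D u v x : open D -> C2_on D u -> v != 0 -> D (refl v x) ->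
  lap_at (u \o refl v) x (laplacian u (refl v x)).
Proof.
move=> oD C2u v0 Dx.
apply: (lap_at_frame (A := fun i => refl v (delta_mx ord0 i)) oD C2u Dx); last first.
  by move=> t i /=; rewrite reflD reflZ.
(* A reflection is an isometric involution, so its matrix is symmetric; sums over columns become
   scalar products of the images of basis vectors. *)
have rE i j : refl v (delta_mx ord0 i) ord0 j = refl v (delta_mx ord0 j) ord0 i.
  by rewrite -!dotv_delta -[in LHS](reflK (delta_mx ord0 j) v0) dotv_refl// dotvC.
move=> j k; under eq_bigr do rewrite !(rE _ j) !(rE _ k).
rewrite -[LHS]/(dotv _ _) dotv_refl// dotv_delta mxE eqxx.
by rewrite eq_sym.
Qed.

(* On coordinate lines the arguments of F here and in lap_at_planar are quadratic polynomials. *)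
Lemma lap_at_radial (F : {poly R}) y x :
  lap_at (fun z => F.[dotv (z - y) (z - y)]) x
    (4 * F^`()^`().[dotv (x - y) (x - y)] * dotv (x - y) (x - y)
      + 2 * N%:R * F^`().[dotv (x - y) (x - y)]).
Proof.
set s := dotv (x - y) (x - y).
exists (fun i => F^`()^`().[s] * (2 * (x - y) ord0 i) ^+ 2 + F^`().[s] * (2 * 1)) => [i|].
  rewrite (_ : (fun t => _) = fun t => F.[s + 2 * (x - y) ord0 i * t + 1 * t ^+ 2]).
    exact: D2at_poly_quadratic.
  apply/funext => t; congr (F.[_]); rewrite /s addrAC !dotvE !(dotvC (delta_mx ord0 i)).
  by rewrite !dotv_delta !mxE !eqxx /=; ring.
rewrite big_split /= sumr_const card_ord -mulr_sumr.
have -> : \sum_(i < N) (2 * (x - y) ord0 i) ^+ 2 = 4 * s.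
  by rewrite /s /dotv mulr_sumr; apply: eq_bigr => i _; ring.
by rewrite -mulr_natr; ring.
Qed.

Lemma lap_at_planar (F : {poly R}) v x :
  lap_at (fun z => F.[dotv z v]) x (F^`()^`().[dotv x v] * dotv v v).
Proof.
exists (fun i => F^`()^`().[dotv x v] * (v ord0 i) ^+ 2 + F^`().[dotv x v] * (2 * 0)) => [i|].
  rewrite (_ : (fun t => _) = fun t => F.[dotv x v + v ord0 i * t + 0 * t ^+ 2]).
    exact: D2at_poly_quadratic.
  apply/funext => t; congr (F.[_]); rewrite !dotvE (dotvC (delta_mx _ _)) dotv_delta.
  by ring.
rewrite big_split /= [X in _ + X]big1 ?addr0; last by move=> i _; ring.
by rewrite -mulr_sumr; congr (_ * _); apply: eq_bigr => i _; rewrite expr2.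
Qed.

End ChainRule.

(** * Maximum principles *)

Section Topology.
Context {R : realType} {N : nat}.
Implicit Types (g h : 'rV[R]_N -> R) (x y z v : 'rV[R]_N) (K : set 'rV[R]_N).

Lemma continuous_dotv v : continuous (fun x => dotv x v).
Proof.
move=> x; apply: (@cvg_dotv _ _ _ (nbhs x) _ id (cst v)); first exact: cvg_id.
exact: cvg_cst.
Qed.

Lemma continuous_sqdist y : continuous (fun x => dotv (x - y) (x - y)).
Proof.
move=> x; have h : (fun z => z - y) @ x --> x - y.
  by apply: (@cvgB _ _ _ (nbhs x) _ id (cst y)); [exact: cvg_id|exact: cvg_cst].
exact: (@cvg_dotv _ _ _ (nbhs x) _ _ _ _ _ h h).
Qed.

Lemma continuous_sqnorm : continuous (fun x => dotv x x).
Proof. by move=> x; apply: (@cvg_dotv _ _ _ (nbhs x) _ id id); exact: cvg_id. Qed.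

Lemma closed_ge_continuous g (a : R) : continuous g -> closed [set x | a <= g x].
Proof. by move=> cg; apply: (preimage_closed _ (@closed_ge R a)) => x _; exact: cg. Qed.

Lemma closed_le_continuous g (a : R) : continuous g -> closed [set x | g x <= a].
Proof. by move=> cg; apply: (preimage_closed _ (@closed_le R a)) => x _; exact: cg. Qed.

Lemma near_lt_continuous g (a : R) x : continuous g -> g x < a -> \forall y \near x, g y < a.
Proof. by move=> /(_ x) /cvgr_lt; exact. Qed.

Lemma near_gt_continuous g (a : R) x : continuous g -> a < g x -> \forall y \near x, a < g y.
Proof. by move=> /(_ x) /cvgr_gt; exact. Qed.

Lemma open_gt_continuous g (a : R) : continuous g -> open [set x | a < g x].
Proof. by move=> cg; apply: (open_comp _ (@open_gt R a)) => x _; exact: cg. Qed.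

(** Passes from sup-norm balls, which define the topology, to Euclidean ones: the sup norm is at
    most [enorm]. *)
Lemma near_sqdist (P : set 'rV[R]_N) y : (\forall x \near y, P x) ->
  exists2 q : R, 0 < q & forall x, dotv (x - y) (x - y) < q -> P x.
Proof.
move=> /nbhs_ballP[r /= r0 hr]; exists (r ^+ 2); first exact: exprn_gt0.
move=> x hx; apply: hr; rewrite -ball_normE /= distrC.
apply: le_lt_trans (norm_le_enorm _) _.
by rewrite -(@ltr_pXn2r _ 2)// ?nnegrE ?enorm_ge0 ?ltW// sqr_enorm.
Qed.

(** The difference of the two sides is |(x - y) - (y - z)|^2. *)
Lemma sqdist_triangle x y z :
  dotv (x - z) (x - z) <= 2 * dotv (x - y) (x - y) + 2 * dotv (y - z) (y - z).
Proof.
rewrite -subr_ge0; have := dotv_ge0 ((x - y) - (y - z)).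
by congr (0 <= _); rewrite !dotvE (dotvC y x) (dotvC z x) (dotvC z y); ring.
Qed.

Lemma compact_sqnorm_le K (a : R) : closed K -> compact (K `&` [set x | dotv x x <= a]).
Proof.
move=> cK; apply: bounded_closed_compact.
  exists (Num.sqrt a); split; first exact: num_real.
  move=> M aM x [_ /= xa]; apply: le_trans (norm_le_enorm _) _.
  by apply: le_trans (ltW aM); exact: ler_wsqrtr.
by apply: closedI => //; apply: closed_le_continuous; exact: continuous_sqnorm.
Qed.

(** Coercivity with [eps = - g x0] bounds the set where [g] is at most [g x0], so a minimum over a
    compact part of [K] is global. *)
Lemma exists_min_coercive K g x0 :
  closed K -> {within K, continuous g} ->
  (forall eps, 0 < eps -> exists A, forall x, K x -> A < dotv x x -> - eps < g x) ->
  K x0 -> g x0 < 0 ->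
  exists x1, [/\ K x1, g x1 < 0 & forall x, K x -> g x1 <= g x].
Proof.
move=> cK cg coer Kx0 g0; have [|A hA] := coer (- g x0); first by rewrite oppr_gt0.
have hA' x : K x -> g x <= g x0 -> dotv x x <= A.
  by move=> Kx gx; rewrite leNgt; apply/negP => /(hA _ Kx); rewrite opprK ltNge gx.
have [||c /set_mem[Kc _] cmin] := @compact_EVT_min _ R g _ _ (compact_sqnorm_le (a := A) cK).
- by exists x0; split=> //=; apply: hA'.
- by apply: continuous_subspaceW cg; exact: subIsetl.
have x0c : g c <= g x0 by apply: cmin; apply/mem_set; split=> //=; exact: hA'.
exists c; split=> //; first exact: le_lt_trans g0.
move=> x Kx; have [gx|gx] := leP (g x) (g x0).
  by apply: cmin; apply/mem_set; split=> //=; exact: hA'.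
exact: le_trans x0c (ltW gx).
Qed.

Lemma within_continuousD K g h : {within K, continuous g} -> {within K, continuous h} ->
  {within K, continuous (fun x => g x + h x)}.
Proof. by move=> cg ch x; apply: continuousD; [exact: cg|exact: ch]. Qed.

Lemma within_continuous_horner (F : {poly R}) g K : continuous g ->
  {within K, continuous (fun x => F.[g x])}.
Proof.
move=> cg; apply: continuous_subspaceT => x.
by apply: (@continuous_comp _ _ _ g (horner F)); [exact: cg|exact: continuous_horner].
Qed.

(** Connectedness of [0,1]: near the supremum of the set where [P] holds, [P] extends to the right
    until 1 is reached. *)
Lemma locally_constant01 (P : R -> Prop) :
  (forall t, 0 <= t <= 1 -> exists2 d, 0 < d & forall s s', 0 <= s <= 1 -> 0 <= s' <= 1 ->
     `|s - t| < d -> `|s' - t| < d -> P s -> P s') ->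
  P 0 -> P 1.
Proof.
move=> loc P0; pose A := [set t | 0 <= t <= 1 /\ P t].
have A0 : A 0 by split=> //; rewrite lexx ler01.
have hA : has_sup A by split; [exists 0|exists 1 => t [/andP[]]].
have T0 : 0 <= sup A by apply: sup_upper_bound.
have T1 : sup A <= 1 by apply: ge_sup; [exists 0|move=> t [/andP[]]].
have [|d d0 hd] := loc (sup A); first by rewrite T0.
have [s [s01 Ps] sd] := sup_adherent d0 hA.
have sT : s <= sup A by apply: sup_upper_bound.
pose s' := Num.min 1 (sup A + d / 2).
have s'T : sup A <= s' by rewrite le_min T1 lerDl ltW// divr_gt0.
have s'1 : s' <= 1 by rewrite ge_min lexx.
have s'd : s' <= sup A + d / 2 by rewrite ge_min lexx orbT.
have Ps' : P s'.
  apply: hd Ps => //; first by rewrite s'1 (le_trans T0 s'T).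
    by rewrite distrC ger0_norm ?subr_ge0//; lra.
  by rewrite ger0_norm ?subr_ge0//; lra.
have : s' <= sup A.
  by apply: sup_upper_bound => //; split=> //; rewrite s'1 (le_trans T0 s'T).
rewrite /s' ge_min => /orP[T1'|]; last by move=> ?; lra.
move: Ps'; rewrite /s' min_l//; lra.
Qed.

End Topology.

(** * The strong maximum principle on balls *)

Section MaximumPrinciples.
Context {R : realType} {N : nat}.
Implicit Types (g w : 'rV[R]_N -> R) (x y z v : 'rV[R]_N) (K : set 'rV[R]_N).

(* The barrier is (q - s)^(m+2) in the squared distance s: for large m it is a strict
   subsolution away from the center. *)
Lemma barrier_subsolution (q eta C : R) : 0 < q -> 0 < eta -> 0 < C ->
  exists F : {poly R}, forall s, eta <= s <= q ->
    [/\ 0 <= F.[s], F.[s] <= F.[0], F.[q] = 0, (s < q -> 0 < F.[s]) &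
    C * F.[s] <= 4 * F^`()^`().[s] * s + 2 * N%:R * F^`().[s]].
Proof.
move=> q0 eta0 C0.
have N0 : 0 <= N%:R :> R by [].
(* Since [eta <= s], this [m] makes the second-order term dominate both the first-order term and the
   term with [C]. *)
have [m hm] : exists m : nat, 2 * N%:R * q + C * q ^+ 2 <= 4 * eta * m%:R.
  have e4 : 0 < 4 * eta by rewrite mulr_gt0.
  exists (Num.bound ((2 * N%:R * q + C * q ^+ 2) / (4 * eta))).
  rewrite -ler_pdivrMl// mulrC ltW//; apply: archi_boundP.
  apply: divr_ge0 (ltW e4); apply: addr_ge0.
    by apply: mulr_ge0 (ltW q0); exact: mulr_ge0.
  by apply: mulr_ge0 (ltW C0) _; exact: sqr_ge0.
pose F : {poly R} := (q%:P - 'X) ^+ m.+2.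
have FE s : F.[s] = (q - s) ^+ m.+2 by rewrite /F !hornerE.
have dF n : ((q%:P - 'X) ^+ n.+1)^`() = - (n.+1%:R *: (q%:P - 'X) ^+ n).
  rewrite deriv_exp -pred_Sn derivB derivC derivX sub0r mulN1r mulNrn.
  by rewrite scaler_nat.
have F'E s : F^`().[s] = - m.+2%:R * (q - s) ^+ m.+1.
  by rewrite /F dF !hornerE; ring.
have F''E s : F^`()^`().[s] = m.+2%:R * m.+1%:R * (q - s) ^+ m.
  by rewrite /F dF derivN derivZ dF !hornerE; ring.
exists F => s /andP[etas sq]; rewrite F'E F''E !FE.
have t0 : 0 <= q - s by rewrite subr_ge0.
have tq : q - s <= q - 0 by lra.
split.
- exact: exprn_ge0.
- by apply: lerXn2r; rewrite // nnegrE; lra.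
- by rewrite subrr expr0n.
- by move=> sq'; rewrite exprn_gt0// subr_gt0.
rewrite -subr_ge0; set t := q - s.
have -> : 4 * (m.+2%:R * m.+1%:R * t ^+ m) * s + 2 * N%:R * (- m.+2%:R * t ^+ m.+1) - C * t ^+ m.+2
  = t ^+ m * (m.+2%:R * (4 * m.+1%:R * s - 2 * N%:R * t) - C * t ^+ 2).
  by rewrite !exprS; ring.
apply: mulr_ge0; first exact: exprn_ge0.
have hm2 : 1 <= m.+2%:R :> R by rewrite ler1n.
have hm1 : m.+1%:R = m%:R + 1 :> R by rewrite -natr1.
have tq' : t <= q by rewrite /t; lra.
have t2 : t ^+ 2 <= q ^+ 2 by apply: lerXn2r; rewrite // nnegrE ltW.
have Ct2 : C * t ^+ 2 <= C * q ^+ 2 by rewrite ler_pM2l.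
have Nt : 2 * N%:R * t <= 2 * N%:R * q by apply: ler_wpM2l => //; exact: mulr_ge0.
have ms : 4 * eta * m%:R <= 4 * m.+1%:R * s.
  have : eta * m%:R <= s * m.+1%:R.
    by apply: ler_pM => //; [exact: ltW|rewrite ler_nat].
  by lra.
have Cq : 0 <= C * q ^+ 2 by apply: mulr_ge0 (ltW C0) _; exact: sqr_ge0.
have X : C * q ^+ 2 <= 4 * m.+1%:R * s - 2 * N%:R * t by lra.
have : 1 * (C * q ^+ 2) <= m.+2%:R * (4 * m.+1%:R * s - 2 * N%:R * t).
  by apply: ler_pM.
by lra.
Qed.

(** Hopf's argument: on the annulus [eta <= d x <= q] a negative multiple of the barrier is added to
    [g]. The sum [G] is positive on the inner sphere and nonnegative on the outer one, so a negative
    minimum [x1] is interior; but there the Laplacian of [G] is at most [C * G x1 < 0]. *)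
Lemma strong_min_ball g y (q C : R) : 0 < q -> 0 < C ->
  {within [set x | dotv (x - y) (x - y) <= q], continuous g} ->
  (forall x, dotv (x - y) (x - y) <= q -> 0 <= g x) ->
  (forall x, dotv (x - y) (x - y) < q -> exists2 L, lap_at g x L & L <= C * g x) ->
  0 < g y -> forall x, dotv (x - y) (x - y) < q -> 0 < g x.
Proof.
move=> q0 C0 cg g0 gC gy x0 x0q.
pose d x := dotv (x - y) (x - y).
have cd : continuous d := @continuous_sqdist R N y.
have dyy : d y = 0 by rewrite /d subrr dot0v.
have [eta [eta0 etaq heta]] : exists eta, [/\ 0 < eta, eta < q &
    forall x, d x <= eta -> g y / 2 < g x].
  have gy2 : g y / 2 < g y by lra.
  have : \forall x \near y, d x <= q -> g y / 2 < g x.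
    have := (subspace_continuousP _ _).1 cg y; rewrite /= -/(d y) dyy ltW// => /(_ isT).
    by move=> /cvgr_gt /(_ _ gy2).
  move=> /near_sqdist[r r0 hr]; exists (Num.min r q / 2).
  have mn0 : 0 < Num.min r q by rewrite lt_min r0.
  have mr : Num.min r q <= r by rewrite ge_min lexx.
  have mq : Num.min r q <= q by rewrite ge_min lexx orbT.
  split; [lra|lra|move=> x dx; apply: hr; rewrite -/(d x); lra].
rewrite ltNge; apply/negP => gx0.
have [F hF] := @barrier_subsolution q eta C q0 eta0 C0.
have qq : eta <= q <= q by rewrite lexx ltW.
have [_ _ Fq _ _] := hF q qq.
have F0 : 0 < F.[0].
  have ee : eta <= eta <= q by rewrite lexx ltW.
  by have [_ h _ /(_ etaq) h' _] := hF eta ee; exact: lt_le_trans h.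
(* As the barrier is at most [F.[0]] on the annulus, this [k] lowers [g] by at most half of [g y],
   and [g] exceeds that half where [d x <= eta]. *)
pose k := - (g y / (2 * F.[0])).
have k0 : k < 0 by rewrite oppr_lt0 divr_gt0// mulr_gt0.
have kF0 : k * F.[0] = - (g y / 2).
  by rewrite /k mulNr; congr (- _); field; rewrite gt_eqF.
pose G x := g x + k * F.[d x].
pose K := [set x | eta <= d x] `&` [set x | d x <= q].
have cG : {within K, continuous G}.
  apply: within_continuousD; first by apply: continuous_subspaceW cg => x [].
  have -> : (fun x => k * F.[d x]) = (fun x => (k *: F).[d x]).
    by apply/funext => x; rewrite hornerZ.
  exact: within_continuous_horner.
have Kx0 : K x0.
  split=> /=; last exact: ltW.
  by rewrite leNgt; apply/negP => /ltW /heta; lra.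
have Gx0 : G x0 < 0.
  rewrite /G; have [_ _ _ /(_ x0q) h _] := hF (d x0) (introT andP Kx0).
  have : k * F.[d x0] < 0 by rewrite nmulr_rlt0.
  lra.
have [x1 [[Kx1 Kx1'] Gx1 x1min]] : exists x1, [/\ K x1, G x1 < 0 & forall x, K x -> G x1 <= G x].
  apply: exists_min_coercive cG _ Kx0 Gx0.
    by apply: closedI; [exact: closed_ge_continuous|exact: closed_le_continuous].
  (* [K] is bounded, so none of its points lies beyond this squared radius. *)
  move=> eps eps0; exists (2 * q + 2 * dotv y y) => x [_ /= xq].
  have := sqdist_triangle x y 0; rewrite !subr0 -/(d x).
  by move=> ? ?; exfalso; lra.
have x1q : d x1 < q.
  rewrite lt_neqAle Kx1' andbT; apply/eqP => dx1.
  by move: Gx1; rewrite /G dx1 Fq mulr0 addr0 ltNge g0.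
have [Fx1 Fx1' _ _ FC] := hF (d x1) (introT andP (conj Kx1 Kx1')).
have x1eta : eta < d x1.
  rewrite lt_neqAle Kx1 andbT; apply/eqP => dx1.
  have : g y / 2 < g x1 by apply: heta; rewrite dx1.
  have : k * F.[0] <= k * F.[d x1] by rewrite ler_nM2l.
  by move: Gx1; rewrite /G kF0; lra.
have [L lapg LC] := gC x1 x1q.
have lapG := lap_at_axpy k lapg (lap_at_radial F y x1).
have x1loc : \forall x \near x1, G x1 <= G x.
  near=> x; apply: x1min; split=> /=; apply: ltW; near: x.
    exact: near_gt_continuous.
  exact: near_lt_continuous.
have := lap_at_min lapG x1loc; rewrite -/(d x1) => h.
have : k * (4 * (F^`())^`().[d x1] * d x1 + 2 * N%:R * F^`().[d x1]) <= k * (C * F.[d x1]).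
  by rewrite ler_nM2l.
have : C * G x1 < 0 by rewrite pmulr_rlt0.
by rewrite /G; lra.
Unshelve. all: by end_near. Qed.

End MaximumPrinciples.

(** * The maximum principle in narrow regions *)

Definition hump {R : realType} (delta c : R) : {poly R} :=
  1%:P + (3 / (4 * delta)) *: 'X - c *: ('X * 'X).

Section NarrowRegion.
Context {R : realType} {N : nat}.
Implicit Types (psi w : 'rV[R]_N -> R) (x y z v : 'rV[R]_N) (K : set 'rV[R]_N).

Lemma humpE (delta c t : R) : (hump delta c).[t] = 1 + 3 / (4 * delta) * t - c * t ^+ 2.
Proof. by rewrite /hump !hornerE. Qed.

Lemma deriv_hump (delta c : R) :
  (hump delta c)^`() = (3 / (4 * delta))%:P - (2 * c) *: 'X.
Proof.
rewrite /hump derivB derivD derivC !derivZ derivM derivX mul1r mulr1 add0r alg_polyC.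
by rewrite -mulr2n -scalerMnr scalerMnl -(mulr_natl c).
Qed.

Lemma deriv_humpE (delta c t : R) : (hump delta c)^`().[t] = 3 / (4 * delta) - 2 * c * t.
Proof. by rewrite deriv_hump !hornerE. Qed.

Lemma deriv2_humpE (delta c t : R) : (hump delta c)^`()^`().[t] = - (2 * c).
Proof. by rewrite deriv_hump derivB derivC derivZ derivX !hornerE. Qed.

(** The linear term is 3/4 at [delta] and 3/2 at [2 * delta], while the quadratic term takes away at
    most 1/2 up to [2 * delta]. Strong concavity, that is a large [c], is bought by a small
    [delta]. *)
Lemma hump_bounds (delta c : R) : 0 < delta -> 0 <= c -> 8 * c * delta ^+ 2 <= 1 ->
  [/\ forall t, 0 <= t <= 2 * delta -> 0 < (hump delta c).[t],
      forall t, 0 <= t <= delta -> (hump delta c).[t] < 2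
    & 2 <= (hump delta c).[2 * delta]].
Proof.
move=> d0 c0 cd; set M := 3 / (4 * delta).
have Md : M * delta = 3 / 4 by rewrite /M; field; rewrite gt_eqF.
have M0 : 0 < M by rewrite divr_gt0// mulr_gt0.
split=> [t /andP[t0 td]|t /andP[t0 td]|]; rewrite humpE -/M.
- have : c * t ^+ 2 <= c * (2 * delta) ^+ 2.
    by apply: ler_wpM2l => //; apply: lerXn2r; rewrite // nnegrE; lra.
  have : 0 <= M * t by rewrite mulr_ge0// ltW.
  rewrite exprMn; lra.
- have : M * t <= M * delta by rewrite ler_pM2l.
  have : 0 <= c * t ^+ 2 by rewrite mulr_ge0// sqr_ge0.
  by lra.
by rewrite exprMn; lra.
Qed.

(* Where w is close to its negative infimum m, w - m/2 * hump(psi) is negative, but the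
   hump keeps it nonnegative on the far side of the region. *)
Lemma narrow_region w psi K (delta c m : R) x0 :
  closed K -> {within K, continuous w} ->
  (forall eps, 0 < eps -> exists A, forall x, K x -> A < dotv x x -> - eps < w x) ->
  continuous psi -> (forall x, K x -> 0 <= psi x) ->
  0 < delta -> 0 <= c -> 8 * c * delta ^+ 2 <= 1 ->
  m < 0 -> (forall x, K x -> m <= w x) ->
  K x0 -> w x0 = m -> psi x0 <= delta ->
  (forall x, K x -> w x < 0 -> psi x < 2 * delta ->
     [/\ nbhs x K & exists L M, [/\ lap_at w x L,
       lap_at (fun z => (hump delta c).[psi z]) x M & L - m / 2 * M < 0]]) ->
  False.
Proof.
move=> cK cw coer cpsi psi0 d0 c0 cd m0 mw Kx0 wx0 psix0 pde.
have [hpos hlt2 hge2] := hump_bounds d0 c0 cd.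
set P := hump delta c in hpos hlt2 hge2 pde.
pose G x := w x + - (m / 2) * P.[psi x].
pose K2 := K `&` [set x | psi x <= 2 * delta].
have cG : {within K2, continuous G}.
  apply: within_continuousD; first by apply: continuous_subspaceW cw => x [].
  have -> : (fun x => - (m / 2) * P.[psi x]) = (fun x => (- (m / 2) *: P).[psi x]).
    by apply/funext => x; rewrite hornerZ.
  exact: within_continuous_horner.
have hK2 x : K2 x -> 0 < - (m / 2) * P.[psi x].
  move=> [Kx /= px]; apply: mulr_gt0; first lra.
  by apply: hpos; rewrite psi0.
have K2x0 : K2 x0 by split=> //=; lra.
have Gx0 : G x0 < 0.
  rewrite /G wx0; have : P.[psi x0] < 2 by apply: hlt2; rewrite psi0.
  rewrite -(ltr_pM2l (_ : 0 < - (m / 2))); last lra.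
  by lra.
have [||x1 [[Kx1 psix1] Gx1 x1min]] := exists_min_coercive _ cG _ K2x0 Gx0.
- by apply: closedI => //; exact: closed_le_continuous.
- move=> eps /coer[A hA]; exists A => x K2x Ax.
  by have := hA x K2x.1 Ax; have := hK2 x K2x; rewrite /G; lra.
have psix1' : psi x1 < 2 * delta.
  rewrite lt_neqAle psix1 andbT; apply/eqP => e.
  move: Gx1; rewrite /G e; have := mw x1 Kx1.
  have : - (m / 2) * 2 <= - (m / 2) * P.[2 * delta] by rewrite ler_pM2l//; lra.
  by lra.
have wx1 : w x1 < 0 by have := hK2 x1 (conj Kx1 psix1); move: Gx1; rewrite /G; lra.
have [nK [L [M [lapw lapP LM]]]] := pde x1 Kx1 wx1 psix1'.
have : 0 <= L + - (m / 2) * M.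
  apply: lap_at_min (lap_at_axpy (- (m / 2)) lapw lapP) _.
  have nP := near_lt_continuous cpsi psix1'.
  by apply: filterS2 nK nP => x Kx px; apply: x1min; split=> //=; exact: ltW.
by lra.
Qed.

End NarrowRegion.

(** * Rotating planes *)

Section Reflections.
Context {R : realType} {N : nat} (rad : R) (u : 'rV[R]_N -> R).
Implicit Types (x y z v : 'rV[R]_N).

(** For [rad = 0] this is the space without the origin and [cext] is the whole space; both cases of
    the domain become one, with the origin as a degenerate inner sphere. *)
Definition ext : set 'rV[R]_N := [set x | rad ^+ 2 < dotv x x].
Definition cext : set 'rV[R]_N := [set x | rad ^+ 2 <= dotv x x].
Definition ext_half v : set 'rV[R]_N := ext `&` [set x | 0 < dotv x v].

(** This is w_v; [refl_gt] is membership in G and [refl_eq] membership in Z. For [v = 0] the half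
    domain is empty and positivity on it vacuous, hence the clause [v != 0] in [refl_gt]. *)
Definition refl_diff v x : R := u x - u (refl v x).

Definition refl_ge v := forall x, ext_half v x -> 0 <= refl_diff v x.
Definition refl_gt v := v != 0 /\ forall x, ext_half v x -> 0 < refl_diff v x.
Definition refl_eq v := forall x, ext x -> refl_diff v x = 0.

Lemma open_ext : open ext.
Proof. exact: open_gt_continuous continuous_sqnorm. Qed.

Lemma closed_cext : closed cext.
Proof. exact: closed_ge_continuous continuous_sqnorm. Qed.

Lemma open_ext_half v : open (ext_half v).
Proof.
by apply: openI; [exact: open_ext|apply: open_gt_continuous; exact: continuous_dotv].
Qed.

Lemma ext_refl v x : v != 0 -> ext x -> ext (refl v x).
Proof. by move=> v0; rewrite /ext /= dotv_refl. Qed.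

Lemma refl_diff_refl v x : v != 0 -> refl_diff v (refl v x) = - refl_diff v x.
Proof. by move=> v0; rewrite /refl_diff reflK// opprB. Qed.

Lemma refl_diff_orth v x : dotv x v = 0 -> refl_diff v x = 0.
Proof. by move=> xv; rewrite /refl_diff refl_orth// subrr. Qed.

Hypothesis u_cont : {within cext, continuous u}.

Lemma refl_diff_continuous v : v != 0 -> {within cext, continuous (refl_diff v)}.
Proof.
move=> v0; apply: within_continuousD => // x; apply: continuousN; move: x.
apply/subspace_continuousP => x Ex.
have Erx : cext (refl v x) by rewrite /cext /= dotv_refl.
have := (subspace_continuousP _ _).1 u_cont _ Erx; apply: cvg_comp.
move=> A /= nA.
have h : refl v @ x --> refl v x.
  exact: (@cvg_reflection _ _ _ (nbhs x) _ (cst v) id v x v0 (cvg_cst v) cvg_id).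
have sub y : (cext (refl v y) -> A (refl v y)) -> cext y -> A (refl v y).
  by move=> hy Ey; apply: hy; rewrite /cext /= dotv_refl.
exact: (@filterS _ (nbhs x) _ _ _ sub (h _ nA)).
Qed.

Hypothesis u_C2 : C2_on ext u.

Lemma continuous_ext x : ext x -> {for x, continuous u}.
Proof. by move=> /mem_set Ex; exact: u_C2.1.1. Qed.

Lemma refl_diff_joint_gt v x : v != 0 -> ext x -> 0 < refl_diff v x ->
  \forall x' \near x & v' \near v, 0 < refl_diff v' x'.
Proof.
move=> v0 Ex h.
have c1 : (fun p : 'rV[R]_N * 'rV[R]_N => p.1) @ filter_prod (nbhs x) (nbhs v) --> x.
  exact: cvg_fst.
have c2 : (fun p : 'rV[R]_N * 'rV[R]_N => p.2) @ filter_prod (nbhs x) (nbhs v) --> v.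
  exact: cvg_snd.
have c3 : (fun p : 'rV[R]_N * 'rV[R]_N => refl p.2 p.1) @ filter_prod (nbhs x) (nbhs v)
    --> refl v x by exact: (cvg_reflection v0 c2 c1).
have d1 := cvg_comp _ _ c1 (continuous_ext Ex).
have d2 := cvg_comp _ _ c3 (continuous_ext (ext_refl v0 Ex)).
have : (fun p : 'rV[R]_N * 'rV[R]_N => refl_diff p.2 p.1) @ filter_prod (nbhs x) (nbhs v)
    --> refl_diff v x by exact: (cvgB d1 d2).
by move=> /cvgr_gt /(_ _ h).
Qed.

(** The product form covers both signs: at a fixed [x], [refl_diff v' x] keeps its sign for [v']
    near [v]. *)
Lemma refl_diff_near_neq v x : v != 0 -> ext x -> refl_diff v x != 0 ->
  \forall v' \near v, 0 < refl_diff v x * refl_diff v' x.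
Proof.
move=> v0 Ex h.
have c3 : (fun v' => refl v' x) @ nbhs v --> refl v x.
  exact: (@cvg_reflection _ _ _ (nbhs v) _ id (cst x) v x v0 cvg_id (cvg_cst x)).
have d2 := cvg_comp _ _ c3 (continuous_ext (ext_refl v0 Ex)).
have d3 : (fun v' => refl_diff v' x) @ nbhs v --> refl_diff v x.
  exact: (cvgB (@cvg_cst _ (u x) _ (nbhs v) _) d2).
have : (fun v' => refl_diff v x * refl_diff v' x) @ nbhs v --> refl_diff v x * refl_diff v x.
  exact: (cvgM (@cvg_cst _ (refl_diff v x) _ (nbhs v) _) d3).
move=> /cvgr_gt; apply.
by rewrite -/(refl_diff v x) -expr2 exprn_even_gt0.
Qed.

Lemma lap_at_refl_diff v x : v != 0 -> ext x ->
  lap_at (refl_diff v) x (laplacian u x - laplacian u (refl v x)).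
Proof.
move=> v0 Ex; have := lap_at_axpy (-1) (lap_at_C2 open_ext u_C2 Ex)
  (lap_at_refl open_ext u_C2 v0 (ext_refl v0 Ex)).
rewrite mulN1r; congr lap_at.
by apply/funext => y; rewrite /= mulN1r.
Qed.

Variable C : R.
Hypothesis C_gt0 : 0 < C.
(** For [y = refl v x] this reads |Lap w_v| <= C |w_v|, which is the linear equation with bounded
    coefficient. *)
Hypothesis lap_lip : forall x y, ext x -> ext y -> dotv x x = dotv y y ->
  `|laplacian u x - laplacian u y| <= C * `|u x - u y|.

Lemma ball_refl_gt v z (q : R) : v != 0 -> refl_ge v -> 0 < q ->
  (forall x, dotv (x - z) (x - z) <= q -> ext_half v x) ->
  0 < refl_diff v z ->
  forall x, dotv (x - z) (x - z) < q -> 0 < refl_diff v x.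
Proof.
move=> v0 vge q0 hq hz; apply: (@strong_min_ball _ _ _ z q C) => //.
- apply: continuous_subspaceW (refl_diff_continuous v0) => x /hq[Ex _].
  exact: ltW.
- by move=> x /hq; exact: vge.
move=> x /ltW /hq hx; exists (laplacian u x - laplacian u (refl v x)).
  by apply: lap_at_refl_diff => //; case: hx.
have [Ex _] := hx; apply: le_trans (ler_norm _) _.
rewrite -[leRHS]/(C * (u x - u (refl v x))) -[u x - _ in leRHS]ger0_norm; last exact: vge.
by apply: lap_lip; rewrite ?dotv_refl//; exact: ext_refl.
Qed.

Lemma local_refl_gt v z : v != 0 -> refl_ge v -> ext_half v z ->
  exists2 q : R, 0 < q & forall x y, dotv (x - z) (x - z) < q ->
    dotv (y - z) (y - z) < q -> 0 < refl_diff v x -> 0 < refl_diff v y.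
Proof.
move=> v0 vge Hz; have [q q0 hq] := near_sqdist (open_nbhs_nbhs (conj (@open_ext_half v) Hz)).
(* The ball used is centred at [x]: with squared radius [q / 3] it stays in the given ball around
   [z], and it contains [y], whose squared distance from [x] is below [q / 4]. *)
exists (q / 16); first by lra.
move=> x y hx hy gx; apply: (@ball_refl_gt v x (q / 3)) => //; first lra.
  by move=> t ht; apply: hq; have := sqdist_triangle t x z; lra.
have := sqdist_triangle y z x.
have -> : dotv (z - x) (z - x) = dotv (x - z) (x - z).
  by rewrite -opprB dotvNl dotvNr opprK.
lra.
Qed.

Lemma segment_refl_gt v x y : v != 0 -> refl_ge v ->
  (forall t : R, 0 <= t <= 1 -> ext_half v (x + t *: (y - x))) ->
  0 < refl_diff v x -> 0 < refl_diff v y.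
Proof.
move=> v0 vge hxy gx.
have := @locally_constant01 R (fun t => 0 < refl_diff v (x + t *: (y - x))).
rewrite scale0r addr0 scale1r [x + (y - x)]addrC subrK; apply => // t t01.
have [q q0 hq] := local_refl_gt v0 vge (hxy t t01).
have h : \forall s \near t,
    dotv (x + s *: (y - x) - (x + t *: (y - x))) (x + s *: (y - x) - (x + t *: (y - x))) < q.
  apply: (@near_line _ _ x (y - x) t
    (fun z => dotv (z - (x + t *: (y - x))) (z - (x + t *: (y - x))) < q)).
  by apply: near_lt_continuous; [exact: continuous_sqdist|rewrite subrr dot0v].
have [d d0 hd] := (nbhs_ballP _ _).1 h.
exists d => // s s' _ _ sd s'd; apply: hq.
  by apply: hd; rewrite -ball_normE /= distrC.
by apply: hd; rewrite -ball_normE /= distrC.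
Qed.

Hypothesis rad_ge0 : 0 <= rad.

Lemma ext_half_scale v x (a : R) : 1 <= a -> ext_half v x -> ext_half v (a *: x).
Proof.
move=> a1 [Ex /= xv]; split; rewrite /ext /= ?dotvZr dotvZl; last first.
  by rewrite mulr_gt0//; lra.
apply: lt_le_trans Ex _; rewrite mulrA ler_peMl ?dotv_ge0//.
by rewrite -[1]mulr1 ler_pM.
Qed.

(** The strong maximum principle on the half domain. Positivity travels from a point [x1] to any [y]
    along three segments that avoid the inner ball: out to [k *: x1], across to [k *: y], and back
    to [y]. *)
Lemma refl_ge_gt v x : v != 0 -> refl_ge v -> ext x -> refl_diff v x != 0 -> refl_gt v.
Proof.
move=> v0 vge Ex hx; split=> // y Hy.
(* [refl_diff v] is odd under the reflection and zero on the hyperplane, so a nonzero value yields a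
   positive one in the half domain. *)
have [x1 Hx1 gx1] : exists2 x1, ext_half v x1 & 0 < refl_diff v x1.
  have [xv|xv|xv] := ltgtP (dotv x v) 0.
  - have Hx1 : ext_half v (refl v x).
      by split; [exact: ext_refl|rewrite /= dotv_refll// oppr_gt0].
    exists (refl v x) => //.
    by rewrite lt_neqAle (vge _ Hx1) andbT eq_sym refl_diff_refl// oppr_eq0.
  - by exists x => //; rewrite lt_neqAle eq_sym hx vge.
  - by move: hx; rewrite refl_diff_orth// eqxx.
have [[Ey /= yv] [Ex1 /= x1v]] := (Hy, Hx1).
pose mu := Num.min (dotv x1 v) (dotv y v).
have mu0 : 0 < mu by rewrite lt_min x1v.
have mux : mu <= dotv x1 v by rewrite ge_min lexx.
have muy : mu <= dotv y v by rewrite ge_min lexx orbT.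
(* On the middle segment z.v is at least [k * mu], which exceeds [rad * enorm v]; by Cauchy-Schwarz
   |z| then exceeds [rad]. *)
pose k := 1 + rad * enorm v / mu.
have k1 : 1 <= k by rewrite lerDl divr_ge0 ?mulr_ge0 ?enorm_ge0// ltW.
have kmu : rad * enorm v < k * mu.
  by rewrite /k mulrDl mul1r divfK ?gt_eqF// ltrDr.
have h1 : 0 < refl_diff v (k *: x1).
  apply: segment_refl_gt gx1 => // t /andP[t0 t1].
  rewrite (_ : _ + _ = (1 + t * (k - 1)) *: x1); last first.
    by rewrite scalerDl scale1r -scalerA scalerBl scale1r.
  by apply: ext_half_scale => //; rewrite lerDl mulr_ge0// subr_ge0.
have h2 : 0 < refl_diff v (k *: y).
  apply: segment_refl_gt h1 => // t /andP[t0 t1].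
  set z := _ + _.
  have zv : k * mu <= dotv z v.
    rewrite /z !dotvE.
    have -> : k * dotv x1 v + t * (k * dotv y v - k * dotv x1 v) =
      k * ((1 - t) * dotv x1 v + t * dotv y v) by ring.
    rewrite ler_pM2l; last lra.
    have : (1 - t) * mu <= (1 - t) * dotv x1 v by rewrite ler_wpM2l// subr_ge0.
    have : t * mu <= t * dotv y v by rewrite ler_wpM2l.
    lra.
  have kmu0 : 0 < k * mu by rewrite mulr_gt0//; lra.
  split; last by rewrite /=; lra.
  rewrite /ext /=; have vv : 0 < dotv v v by rewrite dotv_gt0.
  rewrite -(ltr_pM2r vv); apply: lt_le_trans (dotv_CauchySchwarz z v).
  rewrite -sqr_enorm -exprMn; apply: lt_le_trans (_ : (k * mu) ^+ 2 <= _).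
    rewrite ltr_pXn2r// nnegrE; last exact: ltW.
    by rewrite mulr_ge0// enorm_ge0.
  by rewrite ler_pXn2r// nnegrE; lra.
apply: segment_refl_gt h2 => // t /andP[t0 t1].
rewrite (_ : _ + _ = (k - t * (k - 1)) *: y); last first.
  rewrite scalerBl -scalerA; congr (_ + _).
  by rewrite -scalerN; congr (_ *: _); rewrite scalerBl scale1r opprB.
apply: ext_half_scale => //.
have : t * (k - 1) <= 1 * (k - 1) by rewrite ler_wpM2r// subr_ge0.
lra.
Qed.

End Reflections.

(** * Openness of the set G *)

Section Openness.
Context {R : realType} {N : nat} (rad : R) (u : 'rV[R]_N -> R).
Implicit Types (x y z v : 'rV[R]_N).

Hypothesis u_cont : {within cext rad, continuous u}.
Hypothesis u_C2 : C2_on (ext rad) u.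
Variable C : R.
Hypothesis C_gt0 : 0 < C.
Hypothesis lap_lip : forall x y, ext rad x -> ext rad y -> dotv x x = dotv y y ->
  `|laplacian u x - laplacian u y| <= C * `|u x - u y|.
Hypothesis rad_ge0 : 0 <= rad.
Hypothesis u_bdry : forall x y, dotv x x = rad ^+ 2 -> dotv y y = rad ^+ 2 -> u x = u y.
Hypothesis u_vanish : forall eps : R, 0 < eps ->
  exists A, forall x, A < dotv x x -> `|u x| < eps.
Variable P : R.
(** Expresses that the coefficient c is negative where the squared length exceeds [P]. *)
Hypothesis lap_far : forall x y, ext rad x -> ext rad y -> P < dotv x x ->
  dotv x x = dotv y y -> u x < u y -> laplacian u x < laplacian u y.

Section Minimum.
Variables (v x0 : 'rV[R]_N) (m : R).
Hypothesis v_neq0 : v != 0.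
Let K := cext rad `&` [set x | 0 <= dotv x v].
Hypothesis m_lt0 : m < 0.
Hypothesis m_min : forall x, K x -> m <= refl_diff u v x.
Hypothesis K_x0 : K x0.
Hypothesis m_x0 : refl_diff u v x0 = m.

Lemma closed_half : closed K.
Proof.
apply: closedI; first exact: closed_cext.
by apply: closed_ge_continuous; exact: continuous_dotv.
Qed.

Lemma refl_diff_within : {within K, continuous (refl_diff u v)}.
Proof. by apply: continuous_subspaceW (refl_diff_continuous u_cont v_neq0) => x []. Qed.

Lemma refl_diff_coercive (eps : R) : 0 < eps ->
  exists A, forall x, K x -> A < dotv x x -> - eps < refl_diff u v x.
Proof.
move=> eps0; have [|A hA] := @u_vanish (eps / 2); first by lra.
exists A => x _ Ax; have := hA x Ax; have := hA (refl v x).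
by rewrite dotv_refl// /refl_diff !ltr_norml => /(_ Ax) /andP[? ?] /andP[? ?]; lra.
Qed.

(** [refl_diff v] vanishes on the inner sphere, where [u] is constant, and on the hyperplane, so
    negative values occur only at interior points. *)
Lemma ext_half_of_lt0 x : K x -> refl_diff u v x < 0 -> ext_half rad v x.
Proof.
move=> [Ex /= xv] gx; split=> /=; rewrite ?/ext /= lt_neqAle ?Ex ?xv andbT; apply/eqP => e.
  by move: gx; rewrite /refl_diff (@u_bdry x (refl v x)) ?subrr ?ltxx// dotv_refl.
by move: gx; rewrite refl_diff_orth ?ltxx.
Qed.

Lemma nbhs_half x : K x -> refl_diff u v x < 0 -> nbhs x K.
Proof.
move=> Kx gx; apply: filterS (open_nbhs_nbhs (conj (@open_ext_half R N rad v)
  (ext_half_of_lt0 Kx gx))) => y [Ey yv].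
by split; apply: ltW.
Qed.

Lemma lap_refl_diff_le x : K x -> refl_diff u v x < 0 ->
  laplacian u x - laplacian u (refl v x) <= - C * m.
Proof.
move=> Kx gx; have [Ex _] := ext_half_of_lt0 Kx gx.
apply: le_trans (ler_norm _) _.
apply: le_trans (lap_lip Ex (ext_refl v_neq0 Ex) _) _; first by rewrite dotv_refl.
rewrite mulNr -mulrN ler_pM2l// -/(refl_diff u v x) ltr0_norm// lerN2.
exact: m_min.
Qed.

(** Beyond [P], [u x0 < u (refl v x0)] makes the Laplacian of [refl_diff v] negative, which is
    impossible at an interior minimum. *)
Lemma minimum_not_far : dotv x0 x0 <= P.
Proof.
rewrite leNgt; apply/negP => Px0.
have gx0 : refl_diff u v x0 < 0 by rewrite m_x0.
have [Ex0 _] := ext_half_of_lt0 K_x0 gx0.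
have := lap_at_min (lap_at_refl_diff u_C2 v_neq0 Ex0).
have h : \forall y \near x0, refl_diff u v x0 <= refl_diff u v y.
  by apply: filterS (nbhs_half K_x0 gx0) => y Ky; rewrite m_x0 m_min.
move=> /(_ h); rewrite subr_ge0 leNgt => /negP; apply.
apply: lap_far => //; first exact: ext_refl.
  by rewrite dotv_refl.
by rewrite -subr_lt0.
Qed.

(** Narrow region in the variable x.v: the hump has Laplacian -2 c |v|^2, and [C < c * dotv v v]
    lets it outweigh the bound [- C * m] for [refl_diff v]. *)
Lemma minimum_not_in_strip (delta c : R) : 0 < delta -> 0 <= c -> 8 * c * delta ^+ 2 <= 1 ->
  C < c * dotv v v -> delta < dotv x0 v.
Proof.
move=> d0 c0 cd Cc; rewrite ltNge; apply/negP => x0v.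
apply: (@narrow_region _ _ (refl_diff u v) (fun x => dotv x v) K delta c m x0) => //.
- exact: closed_half.
- exact: refl_diff_within.
- exact: refl_diff_coercive.
- exact: continuous_dotv.
- by move=> x [].
move=> x Kx gx xv; split; first exact: nbhs_half.
have [Ex _] := ext_half_of_lt0 Kx gx.
do 2 eexists; split.
- exact: (lap_at_refl_diff u_C2 v_neq0 Ex).
- exact: lap_at_planar.
rewrite deriv2_humpE; have := lap_refl_diff_le Kx gx.
have : m * (c * dotv v v) < m * C by rewrite ltr_nM2l.
by lra.
Qed.

(** Narrow region in the variable |x|^2 - rad^2. Besides -8 c |x|^2, the Laplacian of the hump
    contains 2 N times its slope, which is at most 3 / (4 delta); the condition on [c] absorbs
    this. *)
Lemma minimum_not_in_shell (delta c : R) : 0 < delta -> 0 <= c -> 8 * c * delta ^+ 2 <= 1 ->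
  C + N%:R * (3 / (4 * delta)) < 4 * c * rad ^+ 2 -> rad ^+ 2 + delta < dotv x0 x0.
Proof.
move=> d0 c0 cd Cc; rewrite ltNge; apply/negP => x0r.
apply: (@narrow_region _ _ (refl_diff u v) (fun x => dotv x x - rad ^+ 2) K delta c m x0) => //.
- exact: closed_half.
- exact: refl_diff_within.
- exact: refl_diff_coercive.
- move=> x; apply: (@cvgB _ _ _ (nbhs x) _ _ (cst (rad ^+ 2))); last exact: cvg_cst.
  exact: continuous_sqnorm.
- by move=> x [Ex _]; rewrite subr_ge0.
- by lra.
move=> x Kx gx xd; split; first exact: nbhs_half.
have [Ex _] := ext_half_of_lt0 Kx gx.
pose s := dotv x x.
exists (laplacian u x - laplacian u (refl v x)).
exists (4 * - (2 * c) * s + 2 * N%:R * (3 / (4 * delta) - 2 * c * (s - rad ^+ 2))); split.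
- exact: (lap_at_refl_diff u_C2 v_neq0 Ex).
- have := lap_at_radial (hump delta c \Po ('X - (rad ^+ 2)%:P)) 0 x.
  rewrite (_ : (fun z => _) = fun z => (hump delta c).[dotv z z - rad ^+ 2]); last first.
    by apply/funext => z; rewrite !subr0 horner_comp !hornerE.
  rewrite !subr0 -/s !deriv_comp !derivXsubC !mulr1 deriv_comp derivXsubC mulr1 !horner_comp.
  by rewrite deriv2_humpE deriv_humpE !hornerE.
have := lap_refl_diff_le Kx gx.
set l := _ - laplacian u _; set M := 3 / (4 * delta).
have r2 : rad ^+ 2 < s by [].
have h1 : 0 <= N%:R * (c * (s - rad ^+ 2)).
  by rewrite mulr_ge0// mulr_ge0//; lra.
have h2 : c * rad ^+ 2 <= c * s by rewrite ler_wpM2l// ltW.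
set X := (4 * _ * _ + _).
have hX : X / 2 < - C by rewrite /X; move: Cc; rewrite -/M; lra.
have : m * - C < m * (X / 2) by rewrite ltr_nM2l.
lra.
Qed.

End Minimum.

(** The constants are fixed for [v] and serve all [v'] near it. A negative minimum of [refl_diff v']
    would lie in the compact part |x|^2 <= P, outside strip and shell, where a covering argument
    shows [refl_diff v'] positive. *)
Lemma refl_gt_near_ge v : refl_gt rad u v -> \forall v' \near v, refl_ge rad u v'.
Proof.
move=> [v0 vgt].
have C0 : 0 < C := C_gt0.
have vv : 0 < dotv v v by rewrite dotv_gt0.
(* Gives [C + 1 < cA * dotv v' v'] as soon as |v'|^2 exceeds |v|^2 / 2. *)
pose cA := 2 * (C + 1) / dotv v v.
have cA0 : 0 < cA by rewrite divr_gt0// mulr_gt0// addr_gt0.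
have [dA [dA0 cdA]] : exists dA, 0 < dA /\ 8 * cA * dA ^+ 2 <= 1.
  exists (Num.min 1 (8 * cA)^-1).
  have c8 : 0 < 8 * cA by rewrite mulr_gt0.
  have h0 : 0 < Num.min 1 (8 * cA)^-1 by rewrite lt_min ltr01 invr_gt0.
  split=> //; rewrite expr2 -[leRHS](mulfV (lt0r_neq0 c8)) ler_pM2l//.
  rewrite -[leRHS]mul1r; apply: ler_pM; rewrite ?(ltW h0)// ge_min lexx ?orbT//.
(* [dB] is the width of the excluded shell, measured in |x|^2. For [rad = 0] it is 0, the inner
   sphere being the origin, which lies in every strip. *)
have [dB [dB0 dBrad hB]] : exists dB,
    [/\ 0 <= dB, dB = 0 -> rad = 0 & forall v' x0 m, v' != 0 -> m < 0 ->
    (forall x, (cext rad `&` [set x | 0 <= dotv x v']) x -> m <= refl_diff u v' x) ->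
    (cext rad `&` [set x | 0 <= dotv x v']) x0 -> refl_diff u v' x0 = m ->
    ext_half rad v' x0 -> rad ^+ 2 + dB <= dotv x0 x0].
  have [->|rad0] := eqVneq rad 0.
    by exists 0; split=> // v' x0 m _ _ _ _ _ [Ex _]; rewrite addr0 ltW.
  have r2 : 0 < rad ^+ 2 by rewrite exprn_gt0// lt0r rad0.
  have N0 : 0 <= N%:R :> R by [].
  (* [c] will meet the shell condition with margin 1; inserted in [8 * c * d ^+ 2 <= 1], and with
     [d <= 1], this reduces to [S * d <= rad ^+ 2]. *)
  pose S := 2 * (N%:R + C + 1).
  have S0 : 0 < S by rewrite /S mulr_gt0// ltr_wpDl// addr_ge0// ltW.
  pose d := Num.min 1 (rad ^+ 2 / S).
  have d0 : 0 < d by rewrite lt_min ltr01 divr_gt0.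
  have d1 : d <= 1 by rewrite ge_min lexx.
  have dS : S * d <= rad ^+ 2.
    by rewrite mulrC -ler_pdivlMr// ge_min lexx orbT.
  pose c := (C + 1 + N%:R * (3 / (4 * d))) / (4 * rad ^+ 2).
  have cE : 4 * c * rad ^+ 2 = C + 1 + N%:R * (3 / (4 * d)).
    by rewrite /c; field; rewrite rad0 gt_eqF.
  have M0 : 0 < 3 / (4 * d) by rewrite divr_gt0// mulr_gt0.
  have c0 : 0 <= c.
    apply: divr_ge0; last by apply/ltW/mulr_gt0.
    apply: addr_ge0; first by apply: addr_ge0 => //; exact: ltW.
    by apply: mulr_ge0 => //; exact: ltW.
  have cd : 8 * c * d ^+ 2 <= 1.
    rewrite -(ler_pM2r r2) mul1r.
    have -> : 8 * c * d ^+ 2 * rad ^+ 2 = 2 * (4 * c * rad ^+ 2) * d ^+ 2 by ring.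
    rewrite cE.
    have -> : 2 * (C + 1 + N%:R * (3 / (4 * d))) * d ^+ 2 =
       (2 * (C + 1) * d + N%:R * (3 / 2)) * d by field; rewrite gt_eqF.
    apply: le_trans dS; rewrite ler_pM2r// /S.
    have : (C + 1) * d <= (C + 1) * 1 by rewrite ler_pM2l//; lra.
    lra.
  exists d; split; [exact: ltW|by move=> e; move: d0; rewrite e ltxx|].
  move=> v' x0 m v'0 m0 mmin Kx0 mx0 _.
  apply/ltW/(@minimum_not_in_shell v' x0 m v'0 m0 mmin Kx0 mx0 d c) => //.
  by rewrite cE; lra.
have near_v'0 : \forall v' \near v, dotv v v / 2 < dotv v' v'.
  by apply: near_gt_continuous; [exact: continuous_sqnorm|lra].
(* Each alternative is an open condition on the pair of [x] and [v'], and each is contradicted by a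
   negative minimum at [x]. *)
pose Q v' x := [\/ dotv x x < rad ^+ 2 + dB, dotv x v' < dA | 0 < refl_diff u v' x].
have near_Q : \forall v' \near v, (cext rad `&` [set x | dotv x x <= P]) `<=` Q v'.
  have /compact_near_coveringP := compact_sqnorm_le (a := P) (@closed_cext R N rad).
  move=> /(_ _ (nbhs v) Q _); apply.
  have pair_near (A B : set 'rV[R]_N) x : (\forall x' \near x, A x') ->
      (\forall v' \near v, B v') -> \forall x' \near x & v' \near v, A x' /\ B v'.
    by move=> nA nB; exists (A, B) => // -[].
  move=> x [Ex _].
  have [xB|xB] := ltP (dotv x x) (rad ^+ 2 + dB).
    have sub (p : 'rV[R]_N * 'rV[R]_N) : dotv p.1 p.1 < rad ^+ 2 + dB /\ setT p.2 -> Q p.2 p.1.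
      by case=> h _; apply: Or31.
    exact: (@filterS _ (filter_prod (nbhs x) (nbhs v)) _ _ _ sub
      (pair_near _ setT x (near_lt_continuous continuous_sqnorm xB) filterT)).
  have [xA|xA] := ltP (dotv x v) dA.
    have c1 : (fun p : 'rV[R]_N * 'rV[R]_N => dotv p.1 p.2) @ filter_prod (nbhs x) (nbhs v)
      --> dotv x v by apply: cvg_dotv; [exact: cvg_fst|exact: cvg_snd].
    have sub (p : 'rV[R]_N * 'rV[R]_N) : dotv p.1 p.2 < dA -> Q p.2 p.1 by exact: Or32.
    by move: c1 => /cvgr_lt /(_ _ xA) /(@filterS _ (filter_prod (nbhs x) (nbhs v)) _ _ _ sub).
  have xv : 0 < dotv x v by exact: lt_le_trans xA.
  have ex : ext rad x.
    rewrite /ext /= lt_neqAle [_ <= _]Ex andbT; apply/eqP => e.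
    have dB00 : dB = 0 by lra.
    have x0 : x = 0 by apply/eqP; rewrite -dotv_eq0 -e (dBrad dB00) expr0n.
    by move: xv; rewrite x0 dot0v ltxx.
  have sub (p : 'rV[R]_N * 'rV[R]_N) : 0 < refl_diff u p.2 p.1 -> Q p.2 p.1 by exact: Or33.
  exact: (@filterS _ (filter_prod (nbhs x) (nbhs v)) _ _ _ sub
    (refl_diff_joint_gt u_C2 v0 ex (vgt x (conj ex xv)))).
near=> v'.
have v'v : dotv v v / 2 < dotv v' v' by near: v'.
have Qv' : (cext rad `&` [set x | dotv x x <= P]) `<=` Q v' by near: v'.
have v'0 : v' != 0 by rewrite -dotv_gt0; lra.
move=> x [Ex /= xv]; rewrite leNgt; apply/negP => gx.
pose K := cext rad `&` [set x | 0 <= dotv x v'].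
have Kx : K x by split; apply: ltW.
have [x0 [Kx0 gx0 x0min]] := exists_min_coercive (@closed_half v')
  (refl_diff_within v'0) (@refl_diff_coercive v' v'0) Kx gx.
have Hx0 := ext_half_of_lt0 v'0 Kx0 gx0.
have x0P := minimum_not_far v'0 gx0 x0min Kx0 erefl.
have x0B := hB v' x0 _ v'0 gx0 x0min Kx0 erefl Hx0.
have x0A : dA < dotv x0 v'.
  apply: (minimum_not_in_strip v'0 gx0 x0min Kx0 erefl dA0 (ltW cA0) cdA).
  have : cA * (dotv v v / 2) < cA * dotv v' v' by rewrite ltr_pM2l.
  have -> : cA * (dotv v v / 2) = C + 1 by rewrite /cA; field; rewrite gt_eqF.
  by lra.
by have [||] := Qv' x0 (conj Kx0.1 x0P); rewrite ltNge ?x0B// ?(ltW x0A)// ?(ltW gx0).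
Unshelve. all: by end_near. Qed.

End Openness.

(** * The cone of reflection directions *)

Section Cone.
Context {R : realType} {N : nat} (rad : R) (u : 'rV[R]_N -> R).
Implicit Types (x y z v e : 'rV[R]_N) (a : R).
Local Notation Gt := (refl_gt rad u).
Local Notation Eq := (refl_eq rad u).

Lemma refl_gtZ a v : 0 < a -> Gt v -> Gt (a *: v).
Proof.
move=> a0 [v0 hv]; have a0' := lt0r_neq0 a0; split; first by rewrite scaler_eq0 negb_or a0'.
move=> x [Ex /=]; rewrite dotvZr pmulr_rgt0// => xv.
by rewrite /refl_diff refl_scale//; exact: hv.
Qed.

Lemma refl_eq0 : Eq 0.
Proof. by move=> x _; rewrite /refl_diff /refl scaler0 subr0 subrr. Qed.

Lemma refl_eqZ a v : Eq v -> Eq (a *: v).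
Proof.
have [->|a0] := eqVneq a 0; first by rewrite scale0r => _; exact: refl_eq0.
by move=> hv x Ex; rewrite /refl_diff refl_scale//; exact: hv.
Qed.

Lemma exists_ext_scale x : x != 0 -> exists2 k, 0 < k & ext rad (k *: x).
Proof.
rewrite -dotv_gt0 => x0; exists (1 + `|rad| / enorm x).
  by rewrite ltr_pwDl// divr_ge0// enorm_ge0.
have e0 : 0 < enorm x by rewrite sqrtr_gt0.
rewrite /ext /= dotvZl dotvZr mulrA -expr2 -sqr_enorm -exprMn mulrDl mul1r divfK ?gt_eqF//.
rewrite -real_normK ?num_real// ltr_pXn2r ?nnegrE ?addr_ge0 ?enorm_ge0//.
by rewrite ltrDr.
Qed.

Lemma refl_gt_not_opp v : Gt v -> ~ Gt (- v).
Proof.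
move=> [v0 h1] [_ h2]; have [k k0 Ex] := exists_ext_scale v0.
have Hx : 0 < dotv (k *: v) v by rewrite dotvZl mulr_gt0// dotv_gt0.
have := h2 (refl v (k *: v)) (conj (ext_refl v0 Ex) _).
rewrite /= dotvNr dotv_refll// opprK => /(_ Hx).
rewrite {1}/refl_diff reflN -/(refl_diff u v _) refl_diff_refl// oppr_gt0.
by have := h1 _ (conj Ex Hx); lra.
Qed.

Lemma refl_gt_not_eq v : Gt v -> ~ Eq v.
Proof.
move=> [v0 h1] h2; have [k k0 Ex] := exists_ext_scale v0.
have Hx : 0 < dotv (k *: v) v by rewrite dotvZl mulr_gt0// dotv_gt0.
by have := h1 _ (conj Ex Hx); rewrite h2// ltxx.
Qed.

(* The two reflections compose to a rotation in the plane of e and z, which agrees with the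
   reflection in e at the point x = |g|^2 e + d g, where g is the part of z orthogonal to e. *)
Lemma refl_gt_not_sum e z : Gt e -> Eq z -> ~ Eq (e - z).
Proof.
move=> Ge Zz Zez; have [e0 he] := Ge.
have E0 : dotv e e != 0 by rewrite dotv_eq0.
have z0 : z != 0 by apply/eqP => z0; move: Zez; rewrite z0 subr0; exact: refl_gt_not_eq.
have ez0 : e - z != 0.
  by apply/eqP => /eqP; rewrite subr_eq0 => /eqP ez; move: Zz; rewrite -ez; exact: refl_gt_not_eq.
pose a := dotv z e / dotv e e.
pose g := z - a *: e.
have ge : dotv g e = 0 by rewrite /g /a !dotvE; field.
have zE : z = a *: e + g by rewrite /g addrC subrK.
clearbody g.
(* [e] and [z] are not parallel, as Z is closed under scaling and disjoint from G. *)
have H0 : 0 < dotv g g.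
  rewrite dotv_gt0; apply/eqP => g0; move: zE; rewrite g0 addr0 => zE.
  have a0 : a != 0 by apply/eqP => a0; move: z0; rewrite zE a0 scale0r eqxx.
  apply: (refl_gt_not_eq Ge); rewrite -[e](scalerK a0) -zE; exact: refl_eqZ.
(* [d] is chosen so that the reflection in [e - z] moves [x0] by -2H(e - z) and the one in [z] then
   moves the image by -2Hz; the total is -2He, the displacement of [x0] under the reflection in
   [e]. *)
pose H := dotv g g; pose d := dotv e e * a * (1 - a) - H.
pose x0 := H *: e + d *: g.
have eg : dotv e g = 0 by rewrite dotvC.
have x0e : dotv x0 e = H * dotv e e by rewrite /x0 !dotvE ge; ring.
have refl_e : refl e x0 = x0 - (2 * H) *: e.
  by rewrite /refl x0e; congr (_ - _ *: _); field.
have refl_2 : refl (e - z) x0 = x0 - (2 * H) *: (e - z).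
  rewrite /refl -mulrA -[dotv (e - z) _]/(dotv (e - z) (e - z)).
  suff -> : dotv x0 (e - z) = H * dotv (e - z) (e - z).
    by rewrite mulfK// dotv_eq0.
  by rewrite zE /x0 /d !dotvE eg ge -/H; ring.
have refl_1 : refl z (refl (e - z) x0) = refl e x0.
  rewrite refl_2 refl_e; set y := x0 - _.
  have -> : refl z y = y - (2 * H) *: z.
    rewrite /refl -mulrA; suff -> : dotv y z = H * dotv z z.
      by rewrite mulfK// dotv_eq0.
    by rewrite /y zE /x0 /d !dotvE eg ge -/H; ring.
  by rewrite /y -addrA -opprD -scalerDr subrK.
have x00 : x0 != 0.
  apply/eqP => x00; move/eqP: x0e; rewrite x00 dot0v eq_sym mulf_eq0 (negbTE E0) orbF.
  by rewrite gt_eqF.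
have [k k0 Ex] := exists_ext_scale x00.
have xe : 0 < dotv (k *: x0) e.
  by rewrite dotvZl x0e mulr_gt0// mulr_gt0// dotv_gt0.
have := he _ (conj Ex xe); rewrite /refl_diff reflZ -refl_1 -!reflZ.
have := Zez _ Ex; rewrite /refl_diff => /eqP; rewrite subr_eq0 => /eqP ->.
have := Zz _ (ext_refl ez0 Ex); rewrite /refl_diff => /eqP; rewrite subr_eq0 => /eqP ->.
by rewrite subrr ltxx.
Qed.

(** Together with the next hypothesis: off Z, membership in G is locally constant. *)
Hypothesis near_gt : forall v, Gt v -> \forall v' \near v, Gt v'.
Hypothesis near_not_gt : forall v, v != 0 -> ~ Gt v -> ~ Eq v -> \forall v' \near v, ~ Gt v'.

Lemma refl_gt_segment e v : Gt e ->
  (forall t : R, 0 <= t <= 1 -> ~ Eq (e + t *: (v - e))) -> Gt v.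
Proof.
move=> Ge hZ; have := @locally_constant01 R (fun t => Gt (e + t *: (v - e))).
rewrite scale0r addr0 scale1r [e + (v - e)]addrC subrK; apply => // t t01.
have nZ := hZ t t01.
have n0 : e + t *: (v - e) != 0 by apply/eqP => h; apply: nZ; rewrite h; exact: refl_eq0.
have [Gv|nG] := pselect (Gt (e + t *: (v - e))).
  have [d /= d0 hd] := (nbhs_ballP _ _).1 (near_line (near_gt Gv)).
  exists d => // s s' _ _ _ s'd _; apply: hd.
  by rewrite -ball_normE /= distrC.
have [d /= d0 hd] := (nbhs_ballP _ _).1 (near_line (near_not_gt n0 nG nZ)).
exists d => // s s' _ _ sd _ Gs; exfalso; apply: (hd s) Gs.
by rewrite -ball_normE /= distrC.
Qed.

(** The segment from [e] to [v] meets Z at some [e + t *: (v - e)] with 0 < t < 1; dividing by [t]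
    gives [a = (1 - t) / t]. *)
Lemma refl_eq_ray e v : Gt e -> ~ Gt v -> ~ Eq v -> exists2 a, 0 < a & Eq (v + a *: e).
Proof.
move=> Ge nG nZ; apply: contrapT => h; apply: nG; apply: (refl_gt_segment Ge).
move=> t /andP[t0 t1] Zt.
have [t00|t00] := eqVneq t 0.
  by move: Zt; rewrite t00 scale0r addr0; exact: refl_gt_not_eq.
have tp : 0 < t by rewrite lt0r t00.
have [t11|t11] := eqVneq t 1.
  by move: Zt; rewrite t11 scale1r addrC subrK.
apply: h; exists ((1 - t) / t).
  by rewrite divr_gt0// subr_gt0 lt_neqAle t11.
have := refl_eqZ t^-1 Zt; congr (Eq _).
rewrite scalerDr scalerA mulVf// scale1r addrCA; congr (v + _).
by rewrite -[X in _ - X]scale1r -scalerBl; congr (_ *: _); field.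
Qed.

Variable e : 'rV[R]_N.
Hypothesis Ge : Gt e.

Lemma refl_eqN v : Eq v -> Eq (- v).
Proof. by rewrite -scaleN1r; exact: refl_eqZ. Qed.

(** Otherwise [v + w] and [- (v + w)], neither of them in G by [refl_gt_not_sum], both start a ray
    in direction [e] that meets Z. The two points of Z add up to [(a + b) *: e], an element of G,
    which [refl_gt_not_sum] forbids. *)
Lemma refl_eqD v w : Eq v -> Eq w -> Eq (v + w).
Proof.
move=> Zv Zw; apply: contrapT => nZ.
have nG : ~ Gt (v + w).
  by move=> /refl_gt_not_sum /(_ Zv); apply; rewrite addrC addKr.
have nG' : ~ Gt (- (v + w)).
  move=> /refl_gt_not_sum /(_ (refl_eqN Zv)); apply.
  by rewrite opprK opprD addrAC addNr add0r; exact: refl_eqN.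
have nZ' : ~ Eq (- (v + w)) by move=> /refl_eqN; rewrite opprK.
have [a a0 Za] := refl_eq_ray Ge nG nZ.
have [b b0 Zb] := refl_eq_ray Ge nG' nZ'.
apply: (refl_gt_not_sum (refl_gtZ (addr_gt0 a0 b0) Ge) Za).
suff -> : (a + b) *: e - (v + w + a *: e) = - (v + w) + b *: e by [].
by apply/rowP => i; rewrite !mxE; ring.
Qed.

(** If the line through [v] parallel to [e] missed Z, [refl_eq_ray] would force both [v] and [- v]
    into G. *)
Lemma exists_refl_eq_shift v : exists a, Eq (v - a *: e).
Proof.
apply: contrapT => h.
have h' a : ~ Eq (v + a *: e) by move=> Z; apply: h; exists (- a); rewrite scaleNr opprK.
have nZ : ~ Eq v by move=> Z; apply: (h' 0); rewrite scale0r addr0.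
have Gv : Gt v.
  by apply: contrapT => nG; have [a _] := refl_eq_ray Ge nG nZ; exact: h'.
have nZ' : ~ Eq (- v) by move=> /refl_eqN; rewrite opprK.
apply: (refl_gt_not_opp Gv); apply: contrapT => nG.
have [a _ /refl_eqN] := refl_eq_ray Ge nG nZ'.
by rewrite opprD opprK -scaleNr; exact: h'.
Qed.

Lemma refl_eqZ_e a : Eq (a *: e) -> a = 0.
Proof.
move=> Za; apply/eqP; apply: contrapT => /negP a0.
by apply: (refl_gt_not_eq Ge); rewrite -[e](scalerK a0); exact: refl_eqZ.
Qed.

(** [p] represents the linear form that reads off the coefficient of [e] when [v] is decomposed
    along Z and [e]. A [v] outside G with v.p > 0 would have some [v + a *: e] with a >= 0 in Z,
    although its coefficient v.p + a is positive. *)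
Lemma exists_half_space : exists p, [/\ p != 0,
  forall v, dotv v p = 0 -> Eq v & forall v, 0 < dotv v p -> Gt v].
Proof.
have [q hq] := choice (fun i : 'I_N => exists_refl_eq_shift (delta_mx ord0 i)).
pose p : 'rV[R]_N := \row_i q i.
have Zp v : Eq (v - dotv v p *: e).
  have -> : v - dotv v p *: e = \sum_i v ord0 i *: (delta_mx ord0 i - q i *: e).
    under eq_bigr do rewrite scalerBr scalerA.
    rewrite sumrB -scaler_suml -row_sum_delta; congr (_ - _ *: _).
    by apply: eq_bigr => i _; rewrite mxE.
  by apply: (big_ind Eq); [exact: refl_eq0|exact: refl_eqD|move=> i _; exact: refl_eqZ].
exists p; split.
- apply/eqP => p0; have := Zp e; rewrite p0 dotvC dot0v scale0r subr0.
  exact: refl_gt_not_eq.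
- by move=> v vp; have := Zp v; rewrite vp scale0r subr0.
move=> v vp; apply: contrapT => nG.
have key a : 0 <= a -> ~ Eq (v + a *: e).
  move=> a0 /refl_eqD /(_ (refl_eqN (Zp v))).
  rewrite opprB addrC addrA subrK -scalerDl => /refl_eqZ_e; lra.
have nZ : ~ Eq v by have := key 0; rewrite scale0r addr0; apply.
by have [a /ltW a0] := refl_eq_ray Ge nG nZ; exact: key.
Qed.

End Cone.

(** * Reduction to the exterior domain *)

Section Domain.
Context {R : realType} {N : nat} (rad : R) (u : 'rV[R]_N -> R).
Implicit Types (x y z v e : 'rV[R]_N).
Hypothesis rad_ge0 : 0 <= rad.

Lemma ext_Sigma x : ext rad x -> Sigma N rad x.
Proof.
rewrite /Sigma /ext; case: eqVneq => // _ /=.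
by rewrite lt_enorm.
Qed.

Lemma Sigma_ext x : Sigma N rad x -> x != 0 -> ext rad x.
Proof.
rewrite /Sigma /ext; case: eqVneq => [-> _|_] /=.
  by rewrite expr0n dotv_gt0.
by rewrite lt_enorm.
Qed.

Lemma C2_on_ext : C2_on (Sigma N rad) u -> C2_on (ext rad) u.
Proof.
have C1sub g : C1_on (Sigma N rad) g -> C1_on (ext rad) g.
  move=> [cg dg]; split=> [x /set_mem /ext_Sigma /mem_set|i]; first exact: cg.
  have [dgi cgi] := dg i.
  by split=> x /set_mem /ext_Sigma /mem_set; [exact: dgi|exact: cgi].
by move=> [C1u C2u]; split=> [|i]; exact: C1sub.
Qed.

Lemma cext_closure : cext rad `<=` closure (Sigma N rad).
Proof.
move=> x Ex; have [rad0|rad0] := eqVneq rad 0.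
  by apply: subset_closure; rewrite /Sigma rad0 eqxx.
move=> B nB.
have h0 : \forall y \near x + 0 *: x, B y by rewrite scale0r addr0.
have [d /= d0 hd] := (nbhs_ballP _ _).1 (near_line h0).
have d20 : 0 < d / 2 by lra.
exists (x + (d / 2) *: x); split.
  apply: ext_Sigma; rewrite /ext /= -[x in x + _]scale1r -scalerDl dotvZl dotvZr.
  apply: (le_lt_trans Ex); rewrite mulrA ltr_pMl.
    by rewrite -expr2 -[ltLHS](expr1n _ 2) ltr_pXn2r ?nnegrE//; lra.
  by apply: lt_le_trans Ex; rewrite exprn_gt0// lt0r rad0.
apply: hd; rewrite -ball_normE /= sub0r normrN gtr0_norm//; lra.
Qed.

Lemma sphere_bdry x : rad != 0 -> dotv x x = rad ^+ 2 -> bdry (Sigma N rad) x.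
Proof.
move=> rad0 xr; split; first by apply: cext_closure; rewrite /cext /= xr.
move=> /interior_subset; rewrite /Sigma (negbTE rad0) /= lt_enorm// xr.
by rewrite ltxx.
Qed.

Lemma vanish_sqnorm (eps : R) : vanishes_at_infinity (Sigma N rad) u -> 0 < eps ->
  exists A, forall x, A < dotv x x -> `|u x| < eps.
Proof.
move=> hu eps0; have [A hA] := hu eps eps0.
exists ((`|A| + rad) ^+ 2) => x hx.
have r0 := rad_ge0.
have Ax : `|A| + rad < enorm x by rewrite lt_enorm// addr_ge0.
apply: hA; last by have := ler_norm A; lra.
by apply: ext_Sigma; rewrite /ext /= -lt_enorm//; have := normr_ge0 A; lra.
Qed.

End Domain.

(** * Lipschitz bound and monotonicity of the nonlinearity *)

Section Nonlinearity.
Context {R : realType} {N : nat} (rad : R) (f : R -> R -> R).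
Hypothesis f_diff : forall r, rad <= r -> forall s, derivable (f r) s 1.

Lemma nonlinearity_MVT (r a b : R) : rad <= r -> a < b ->
  exists2 c, a < c < b & f r b - f r a = derive1 (f r) c * (b - a).
Proof.
move=> rr ab; have [||c cab ->] := @MVT R (f r) (derive1 (f r)) a b ab.
- by move=> x _; rewrite derive1E; apply: derivableP; exact: f_diff.
- by apply: derivable_within_continuous => x _; exact: f_diff.
by exists c => //; move: cab; rewrite in_itv.
Qed.

Lemma nonlinearity_lipschitz (K : R) : 0 < K ->
  (forall K : R, 0 < K ->
     (ereal_sup [set (`|derive1 (f r) s|%R)%:E
                | r in `[rad, +oo[ & s in [set s : R | (`|s| <= K)%R]] < +oo)%E) ->
  exists2 C, 0 < C & forall r a b, rad <= r -> `|a| <= K -> `|b| <= K ->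
    `|f r a - f r b| <= C * `|a - b|.
Proof.
move=> K0 /(_ K K0); set S := ereal_sup _ => Soo.
have ub (r s : R) : rad <= r -> `|s| <= K -> (`|derive1 (f r) s|%:E <= S)%E.
  move=> rr sK; apply: (elimT ereal_supP (lexx _)).
  by exists r; [rewrite /= in_itv /= andbT|exists s].
have [C C0 hC] : exists2 C, 0 < C & forall r s, rad <= r -> `|s| <= K ->
    `|derive1 (f r) s| <= C.
  (* If the supremum is -oo, there is no admissible pair of [r] and [s], and any constant serves. *)
  case: S Soo ub => [C _ ub|//|_ ub]; last first.
    by exists 1 => // r s rr sK; have := ub r s rr sK.
  exists (`|C| + 1); first by rewrite ltr_wpDl.
  move=> r s rr sK; have := ub r s rr sK; rewrite lee_fin => /le_trans; apply.
  by have := ler_norm C; lra.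
exists C => // r a b rr aK bK.
have lt_case a' b' : `|a'| <= K -> `|b'| <= K -> a' < b' -> `|f r b' - f r a'| <= C * `|b' - a'|.
  move=> a'K b'K /(nonlinearity_MVT rr)[c /andP[a'c cb'] ->].
  move: a'K b'K; rewrite 2!ler_norml => /andP[? ?] /andP[? ?].
  rewrite normrM ler_wpM2r//; apply: hC => //; rewrite ler_norml; apply/andP; split; lra.
have [ab|ba|->] := ltgtP a b; last by rewrite !subrr normr0 mulr0.
  by rewrite distrC (distrC a); exact: lt_case.
exact: lt_case.
Qed.

(** Uniform continuity at 0 gives one [d] for all [r] such that f_u(r, s) < - gamma / 2 for |s| < d;
    the mean value theorem concludes. *)
Lemma nonlinearity_decreasing (rho gamma : R) : 0 < gamma ->
  (forall r, rad < r -> rho < r -> derive1 (f r) 0 < - gamma) ->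
  (forall v : R,
     ereal_sup [set `|derive1 (f r) s - derive1 (f r) v|%:E | r in `[rad, +oo[]
       @[s --> v^'] --> 0%E) ->
  exists2 d, 0 < d & forall r a b, rad < r -> rho < r -> `|a| < d -> `|b| < d -> a < b ->
    f r b < f r a.
Proof.
move=> g0 neg /(_ 0).
have g2 : (0 < (gamma / 2)%:E)%E by rewrite lte_fin divr_gt0.
move=> /(_ _ (open_ereal_lt' g2)) [d /= d0 hd].
exists d => // r a b rr rhor; rewrite !ltr_norml => /andP[? ?] /andP[? ?] ab.
rewrite -subr_lt0; have [c /andP[ac cb] ->] := nonlinearity_MVT (ltW rr) ab.
rewrite pmulr_llt0 ?subr_gt0//; have f0 := neg r rr rhor.
(* The limit at 0 is over a punctured neighbourhood, so [c = 0] is treated apart. *)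
have [->|c0] := eqVneq c 0; first by lra.
have := hd c; rewrite /= sub0r normrN ltr_norml => /(_ _ c0) h.
have {h} : (ereal_sup [set `|derive1 (f r) c - derive1 (f r) 0|%:E | r in `[rad, +oo[]
    < (gamma / 2)%:E)%E.
  by apply: h; apply/andP; split; lra.
apply: contraTlt => fc; rewrite -leNgt.
have : (`|derive1 (f r) c - derive1 (f r) 0|%:E <=
    ereal_sup [set `|derive1 (f r) c - derive1 (f r) 0|%:E | r in `[rad, +oo[])%E.
  apply: (elimT ereal_supP (lexx _)); exists r => //=.
  by rewrite in_itv /= andbT ltW.
apply: le_trans; rewrite lee_fin; apply: le_trans (ler_norm _); lra.
Qed.

End Nonlinearity.

(** * From the half space of directions to the polar angle *)

Section Conclusion.
Context {R : realType} {N : nat} (rad : R) (u : 'rV[R]_N -> R).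
Implicit Types (x y z v e p : 'rV[R]_N).

Lemma polar_angleE p x : polar_angle p x = acos (dotv x p / enorm x).
Proof. by rewrite /polar_angle dotvZl mulrC. Qed.

Lemma cos_bounds p x : usphere N p -> x != 0 -> -1 <= dotv x p / enorm x <= 1.
Proof.
move=> p1 x0; have e0 : 0 < enorm x by rewrite sqrtr_gt0 dotv_gt0.
have := dotv_CauchySchwarz x p; rewrite -(sqr_enorm p) p1 expr1n mulr1 -sqr_enorm.
rewrite -real_normK ?num_real// ler_pXn2r ?nnegrE ?enorm_ge0// => h.
rewrite -ler_norml normrM normfV (gtr0_norm e0) ler_pdivrMr// mul1r.
exact: h.
Qed.

Lemma lt_polar_angle p x y : usphere N p -> x != 0 -> y != 0 -> enorm x = enorm y ->
  (polar_angle p x < polar_angle p y) = (dotv y p < dotv x p).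
Proof.
move=> p1 x0 y0 xy; have e0 : 0 < enorm y by rewrite sqrtr_gt0 dotv_gt0.
have bx := cos_bounds p1 x0; have by_ := cos_bounds p1 y0.
have [rx cx] := acos_def bx; have [ry cy] := acos_def by_.
rewrite !polar_angleE -[RHS](ltr_pM2r (_ : 0 < (enorm y)^-1)) ?invr_gt0//.
rewrite [RHS](_ : _ = (cos (acos (dotv y p / enorm y)) < cos (acos (dotv x p / enorm x)))).
  by rewrite ltr_cos ?in_itv.
by rewrite cx cy xy.
Qed.

Lemma half_space_foliated p : 0 <= rad -> p != 0 -> {within Sigma N rad, continuous u} ->
  (forall v, dotv v p = 0 -> refl_eq rad u v) ->
  (forall v, 0 < dotv v p -> refl_gt rad u v) ->
  exists p, [/\ usphere N p, foliated_schwarz_symmetric (Sigma N rad) p u &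
    decreasing_in_angle (Sigma N rad) p u].
Proof.
move=> rad0 p0 cu heq hgt; have e0 : 0 < enorm p by rewrite sqrtr_gt0 dotv_gt0.
pose q := (enorm p)^-1 *: p.
have q1 : usphere N q.
  rewrite /usphere /= {1}/enorm /q dotvZl dotvZr -sqr_enorm mulrA -expr2 -exprMn.
  by rewrite mulVf ?gt_eqF// expr1n sqrtr1.
have qE x : dotv x q = (enorm p)^-1 * dotv x p by rewrite dotvZr.
have eq_u x y : ext rad x -> enorm x = enorm y -> dotv x q = dotv y q -> u x = u y.
  move=> Ex xy; rewrite !qE => /(mulfI (invr_neq0 (lt0r_neq0 e0))) xp.
  have xx : dotv x x = dotv y y by rewrite -!sqr_enorm xy.
  have : refl_eq rad u (x - y) by apply: heq; rewrite !dotvE xp subrr.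
  by move=> /(_ x Ex) /eqP; rewrite /refl_diff refl_swap// subr_eq0 => /eqP.
have lt_u x y : ext rad x -> enorm x = enorm y -> dotv y q < dotv x q -> u y < u x.
  move=> Ex xy; rewrite !qE ltr_pM2l ?invr_gt0// => xp.
  have xx : dotv x x = dotv y y by rewrite -!sqr_enorm xy.
  have [v0] : refl_gt rad u (x - y) by apply: hgt; rewrite !dotvE subr_gt0.
  move=> /(_ x); rewrite /refl_diff refl_swap// subr_gt0; apply; split=> //=.
  have := v0; rewrite -dotv_gt0.
  (* As |x| = |y|, this places [x] on the positive side of the hyperplane orthogonal to [x - y]. *)
  have -> : dotv (x - y) (x - y) = 2 * dotv x (x - y).
    by rewrite !dotvE (dotvC y x) -xx; ring.
  by rewrite pmulr_rgt0.
exists q; split=> //; last first.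
  move=> x y Dx _ x0 y0 xy; rewrite lt_polar_angle//.
  exact: lt_u (Sigma_ext rad0 Dx x0) xy.
split=> //.
  (* [A] fixes the origin; elsewhere it preserves |x| and x.q, which determine [u x]. *)
  move=> A AA qA x Dx; have [->|x0] := eqVneq x 0; first by rewrite mul0mx.
  have dotA y z : dotv (y *m A) (z *m A) = dotv y z.
    have dE (a b : 'rV[R]_N) : dotv a b = (a *m b^T) ord0 ord0.
      by rewrite mxE; apply: eq_bigr => i _; rewrite mxE.
    by rewrite !dE trmx_mul mulmxA -(mulmxA y) AA mulmx1.
  apply/esym/eq_u; first exact: Sigma_ext.
    by rewrite /enorm dotA.
  by rewrite -[q in RHS]qA dotA.
move=> x y Dx Dy x0 y0 xy; rewrite leNgt lt_polar_angle// -leNgt le_eqVlt => /predU1P[xyq|xyq].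
  by rewrite (@eq_u x y)//; exact: Sigma_ext.
by apply/ltW/lt_u => //; exact: Sigma_ext.
Qed.

End Conclusion.

Theorem corollary1p7 (R : realType) (N : nat) (rad : R)
  (f : R -> R -> R) (rho gamma : R) (u : 'rV[R]_N -> R) (e : 'rV[R]_N)
  (hN : (2 <= N)%N) (hrad : 0 <= rad)
  (f_cont : forall s : R, {within `[rad, +oo[, continuous (f ^~ s)})
  (f_diff : forall r : R, rad <= r -> forall s : R, derivable (f r) s 1)
  (f_C1 : forall r : R, rad <= r -> continuous (derive1 (f r)))
  (fu_unif : forall v : R,
     ereal_sup [set `|derive1 (f r) s - derive1 (f r) v|%:E | r in `[rad, +oo[]
       @[s --> v^'] --> 0%E)
  (fu_bound : forall K : R, 0 < K ->
     (ereal_sup [set (`|derive1 (f r) s|%R)%:E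
                | r in `[rad, +oo[ & s in [set s : R | (`|s| <= K)%R]] < +oo)%E)
  (hrho : 0 < rho) (hgamma : 0 < gamma)
  (fu_neg : forall x : 'rV[R]_N, Sigma N rad x -> rho < enorm x ->
     derive1 (f (enorm x)) 0 < - gamma)
  (u_C2 : C2_on (Sigma N rad) u)
  (u_cont : {within closure (Sigma N rad), continuous u})
  (u_bounded : exists M : R, forall x, Sigma N rad x -> `|u x| <= M)
  (u_eq : forall x, Sigma N rad x -> - laplacian u x = f (enorm x) (u x))
  (u_bc : forall x : 'rV[R]_N, bdry (Sigma N rad) x -> u x = 0)
  (u_infty : vanishes_at_infinity (Sigma N rad) u)
  (he : usphere N e)
  (u_refl : forall x, half_of (Sigma N rad) e x -> u (reflection e x) <= u x)
  (u_neq : exists2 x, Sigma N rad x & u x <> u (reflection e x)) :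
  exists p : 'rV[R]_N,
    [/\ usphere N p,
        foliated_schwarz_symmetric (Sigma N rad) p u
      & decreasing_in_angle (Sigma N rad) p u].
Proof.
have e0 : e != 0.
  by apply/eqP => e0; move/eqP: he; rewrite e0 /enorm dot0v sqrtr0 eq_sym oner_eq0.
have uc : {within cext rad, continuous u}.
  by apply: continuous_subspaceW u_cont; exact: cext_closure.
have uC2 : C2_on (ext rad) u by exact: C2_on_ext.
have [K K0 uK] : exists2 K, 0 < K & forall x, Sigma N rad x -> `|u x| <= K.
  have [M hM] := u_bounded; exists (`|M| + 1); first by rewrite ltr_wpDl.
  by move=> x /hM /le_trans; apply; have := ler_norm M; lra.
have [C C0 fC] := nonlinearity_lipschitz f_diff K0 fu_bound.
have lapE x : ext rad x -> laplacian u x = - f (enorm x) (u x).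
  by move=> /(ext_Sigma hrad) /u_eq <-; rewrite opprK.
have radE x : ext rad x -> rad < enorm x by rewrite lt_enorm.
have lip x y : ext rad x -> ext rad y -> dotv x x = dotv y y ->
    `|laplacian u x - laplacian u y| <= C * `|u x - u y|.
  move=> Ex Ey xy; have nxy : enorm x = enorm y by rewrite /enorm xy.
  rewrite !lapE// nxy -opprD normrN.
  by apply: fC; [exact/ltW/radE|exact/uK/(ext_Sigma hrad)..].
have vanish (eps : R) : 0 < eps -> exists A, forall x, A < dotv x x -> `|u x| < eps.
  by move=> eps0; exact: (vanish_sqnorm hrad u_infty eps0).
(* The assumption on f_u concerns points of the domain; the multiple of [e] of length [r] realises
   each radius. *)
have neg r : rad < r -> rho < r -> derive1 (f r) 0 < - gamma.
  move=> rr rhor; have r0 : 0 < r by exact: le_lt_trans rr.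
  have ne : enorm ((r / enorm e) *: e) = r.
    rewrite he divr1 /enorm dotvZl dotvZr -sqr_enorm he expr1n mulr1 -expr2 sqrtr_sqr.
    exact: gtr0_norm.
  rewrite -ne; apply: fu_neg; rewrite ?ne//.
  by apply: ext_Sigma => //; rewrite /ext /= -lt_enorm// ne.
have [d d0 fd] := nonlinearity_decreasing f_diff hgamma neg fu_unif.
have [A hA] := vanish d d0.
(* The threshold is for squared lengths: beyond [A] the values of [u] are small enough for [fd], and
   [rho ^+ 2] encodes |x| > rho. *)
have far x y : ext rad x -> ext rad y -> Num.max A (rho ^+ 2) < dotv x x ->
    dotv x x = dotv y y -> u x < u y -> laplacian u x < laplacian u y.
  rewrite gt_max => Ex Ey /andP[Ax rx] xy uxy.
  have nxy : enorm x = enorm y by rewrite /enorm xy.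
  rewrite !lapE// nxy ltrN2; apply: fd => //; first exact: radE.
  - by rewrite lt_enorm -?xy// ltW.
  - exact: hA.
  - by apply: hA; rewrite -xy.
(* For [rad = 0] the sphere is the origin alone, so [x] and [y] coincide. *)
have bd x y : dotv x x = rad ^+ 2 -> dotv y y = rad ^+ 2 -> u x = u y.
  have [rad0|rad0] := eqVneq rad 0.
    rewrite rad0 expr0n /= => /eqP; rewrite dotv_eq0 => /eqP -> /eqP.
    by rewrite dotv_eq0 => /eqP ->.
  by move=> xr yr; rewrite !u_bc//; exact: sphere_bdry.
have ge_gt := refl_ge_gt uc uC2 C0 lip hrad.
have near_ge := refl_gt_near_ge uc uC2 C0 lip hrad bd vanish far.
(* For [v'] near [v], [refl_diff v'] is nonnegative on its half domain and nonzero at the fixed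
   point [k *: v], so the strong maximum principle makes it positive. *)
have near_gt v : refl_gt rad u v -> \forall v' \near v, refl_gt rad u v'.
  move=> Gv; have [v0 hv] := Gv; have [k k0 Ex] := exists_ext_scale rad v0.
  have hx : refl_diff u v (k *: v) != 0.
    by rewrite gt_eqF// hv//; split=> //=; rewrite dotvZl mulr_gt0// dotv_gt0.
  have v'0 : \forall v' \near v, 0 < dotv v' v'.
    by apply: near_gt_continuous; [exact: continuous_sqnorm|rewrite dotv_gt0].
  apply: filterS3 v'0 (near_ge v Gv) (refl_diff_near_neq uC2 v0 Ex hx) => v'.
  rewrite dotv_gt0 => v'0 ge' gx; apply: (ge_gt v' (k *: v)) => //.
  by apply/eqP => g0; move: gx; rewrite g0 mulr0 ltxx.
(* By the strong maximum principle, a [v] outside G and Z has a negative value in its half domain;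
   the same point gives a negative value for every nearby [v']. *)
have near_not v : v != 0 -> ~ refl_gt rad u v -> ~ refl_eq rad u v ->
    \forall v' \near v, ~ refl_gt rad u v'.
  move=> v0 nG nZ; have [x Hx gx] : exists2 x, ext_half rad v x & refl_diff u v x < 0.
    apply: contrapT => h; apply: nZ => x Ex; apply/eqP; apply: contrapT => /negP hx.
    apply/nG/(ge_gt v x) => // y Hy; rewrite leNgt; apply/negP => gy.
    by apply: h; exists y.
  have [Ex xv] := Hx.
  have nx : \forall v' \near v, 0 < dotv v' x.
    by apply: near_gt_continuous; [exact: continuous_dotv|rewrite dotvC].
  have hx : refl_diff u v x != 0 by rewrite lt_eqF.
  apply: filterS2 nx (refl_diff_near_neq uC2 v0 Ex hx) => v' xv' gg [_ hv'].
  have : 0 < refl_diff u v' x by apply: hv'; split=> //=; rewrite dotvC.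
  by move: gg; rewrite nmulr_rgt0//; lra.
(* The point where [u] differs from its reflection is not the origin, which reflections fix; so it
   lies in [ext]. *)
have Ge : refl_gt rad u e.
  have [x Dx ux] := u_neq.
  have x0 : x != 0.
    apply/eqP => x0; apply: ux.
    by rewrite x0 /reflection dot0v mulr0 scale0r subr0.
  apply: (ge_gt e x) => //; first last.
  - by rewrite subr_eq0; apply/eqP; rewrite -reflectionE.
  - exact: Sigma_ext.
  move=> y [Ey ye]; rewrite subr_ge0 -reflectionE//; apply: u_refl.
  by split=> //; exact: ext_Sigma.
have [p [p0 peq pgt]] := exists_half_space near_gt near_not Ge.
apply: (half_space_foliated hrad p0) => //.
by apply: continuous_subspaceW u_cont; exact: subset_closure.
Qed.
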